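(* Let $X$ be an effective Banach space that is not zero-dimensional. Then there exist bounded linear operators on $X$ that are not quasi-effective; in particular the operator $x\mapsto\sqrt{2}\,x$ (which is effective) is not quasi-effective.
   Context: $X$ is an effective Banach space (a Banach space with a Pour-El–Richards computability structure admitting a computable sequence $(e_n)$ with dense linear span), $X_k$ its set of computable elements; $(a_n)$ is a computable enumeration of the rational span $A$ of $(e_n)$. $\varphi_e$ is the $e$-th partial recursive function; $\varphi_{e,n}(m)\downarrow$ means the computation of $\varphi_e(m)$ halts within $n$ steps, $\uparrow$ that it does not. For $e,k\in\mathbb{N}$ the quasi-sequence $(\beta\langle e,k\rangle)_n$ is defined by cases: if $\varphi_{e,n}(0)\uparrow$ then $(\beta\langle e,k\rangle)_n=a_0$; otherwise $(\beta\langle e,k\rangle)_n=a_{\varphi_{e,n}(0)}$ if $\varphi_{e,n}(0)\downarrow$ and ($n$ is the least $n'$ with $\varphi_{e,n'}(0)\downarrow$, or $\varphi_{e,n}(1)\uparrow$); otherwise $(\beta\langle e,k\rangle)_n=a_{\varphi_{e,n}(m)}$ where $m$ is such that $\varphi_{e,n}(m)\downarrow$, $\|a_{\varphi_e(m)}-a_{\varphi_e(m-1)}\|<2^{-m}k$, and ($n$ is the least $n'$ with $\varphi_{e,n'}(m)\downarrow$, or $\varphi_{e,n}(m+1)\uparrow$, or $\|a_{\varphi_e(m+1)}-a_{\varphi_e(m)}\|>k\cdot2^{-(m+1)}$). Intended meaning: it follows $a_{\varphi_e(0)},a_{\varphi_e(1)},\dots$ while values are computed and consecutive differences obey the bound,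 and becomes constant otherwise. $\beta\langle e,k\rangle\in X_k$ is the limit of this sequence; $\beta$ is a total numbering of $X_k$. An operator $F$ on $X_k$ is quasi-effective if there is a partial recursive $\psi$ with $F(\beta i)=\beta\psi(i)$ for all $i$; it is effective if the analogous condition holds for the standard numbering $\alpha$ ($e\in\operatorname{dom}\alpha$ iff $\varphi_e$ total and $\|a_{\varphi_e(n)}-\lim_m a_{\varphi_e(m)}\|<2^{-n}$ for all $n$, $\alpha e=\lim_m a_{\varphi_e(m)}$).
   Formalization: That √2·x is not quasi-effective is proved only if a_0 ≠ 0 or √2·x leaves the rational span A for some x in A; otherwise it can fail, e.g. X = ℝ, e = (1, √2, 0, …), a_0 = 0. The existence claim is unconditional. *)

(* Defs.v *)
From Stdlib Require Cantor.
From HB Require Import structures.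
From mathcomp Require Import all_boot all_order all_algebra.
From mathcomp Require Import complex.
From mathcomp Require Import all_classical all_reals all_analysis.
Set Implicit Arguments.
Unset Strict Implicit.
Unset Printing Implicit Defensive.
Import Order.TTheory GRing.Theory Num.Theory.
Import numFieldNormedType.Exports.
Local Open Scope classical_set_scope.
Local Open Scope ring_scope.

Definition npair (x y : nat) : nat := Cantor.to_nat (x, y).
Definition nfst (i : nat) : nat := (Cantor.of_nat i).1.
Definition nsnd (i : nat) : nat := (Cantor.of_nat i).2.

(* [phi n e x] is phi_{e,n}(x): [Some y] if phi_e(x) halts with value y within
   n steps, [None] otherwise.  Indices are Goedel numbers of unary
   mu-recursive schemes on nat, several arguments being coded by [npair]:
     0, 1, 2, 3           zero, successor, first and second projection;
     4 + 4<f,g>           x |-> <f(x), g(x)>;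
     4 + 4<f,g> + 1       x |-> f(g(x));
     4 + 4<f,g> + 2       h<a,0> = f(a), h<a,m+1> = g<a,<m,h<a,m>>>;
     4 + 4f + 3           <a,m> |-> least m' >= m with f<a,m'> = 0.
   As usual the number of steps also bounds the arguments: if phi_{e,n}(x)
   halts then x < n. *)
Fixpoint phi (n e x : nat) {struct n} : option nat :=
  match n with
  | 0%N => None
  | n'.+1 =>
    if (n' < x)%N then None else
    match e with
    | 0%N => Some 0%N
    | 1%N => Some x.+1
    | 2%N => Some (nfst x)
    | 3%N => Some (nsnd x)
    | e'.+4 =>
      let c := (e' %/ 4)%N in
      let f := nfst c in
      let g := nsnd c in
      match (e' %% 4)%N with
      | 0%N => obind (fun u => omap (npair u) (phi n' g x)) (phi n' f x)
      | 1%N => obind (phi n' f) (phi n' g x)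
      | 2%N =>
        let a := nfst x in
        match nsnd x with
        | 0%N => phi n' f a
        | m.+1 => obind (fun u => phi n' g (npair a (npair m u)))
                        (phi n' e (npair a m))
        end
      | _ =>
        obind (fun u => if u == 0%N then Some (nsnd x)
                        else phi n' e (npair (nfst x) (nsnd x).+1))
              (phi n' c x)
      end
    end
  end.

Definition halts (n e x : nat) : bool := isSome (phi n e x).

(* phi_e(x) is defined and equal to y *)
Definition computes (e x y : nat) : Prop := exists n, phi n e x = Some y.

Definition recursive (f : nat -> nat) : Prop :=
  exists e, forall x, computes e x (f x).

Definition computable_rat_seq (r : nat -> rat) : Prop :=
  exists s p q : nat -> nat,
    [/\ recursive s, recursive p, recursive q &
        forall n, q n != 0%N /\ r n = (-1) ^+ s n * (p n)%:R / (q n)%:R].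

Definition computable_real_seq (R : realType) (x : nat -> R) : Prop :=
  exists r : nat -> rat, computable_rat_seq r /\
    forall n k, `|ratr (r (npair n k)) - x n| <= 2 ^- k.

(* Banach spaces are real or complex. *)
Variant scalars (R : realType) : numFieldType -> Type :=
  | RealScalars : scalars R R
  | ComplexScalars : scalars R R[i].

Definition of_real (R : realType) (K : numFieldType) (sc : scalars R K) :
    R -> K :=
  match sc in scalars _ K return R -> K with
  | RealScalars => fun x => x
  | ComplexScalars => fun x => x%:C%C
  end.

Definition rational_scalars (R : realType) (K : numFieldType)
    (sc : scalars R K) : set K :=
  match sc in scalars _ K return set K with
  | RealScalars => [set z | exists p : rat, z = ratr p]
  | ComplexScalars =>
      [set z | exists p q : rat, z = (ratr p +i* ratr q)%C]
  end.

Definition computable_scalar_seq (R : realType) (K : numFieldType)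
    (sc : scalars R K) : (nat -> K) -> Prop :=
  match sc in scalars _ K return (nat -> K) -> Prop with
  | RealScalars => fun z => computable_real_seq z
  | ComplexScalars => fun z =>
      computable_real_seq (fun n => complex.Re (z n)) /\
      computable_real_seq (fun n => complex.Im (z n))
  end.

Section EffectiveBanach.
Variables (R : realType) (K : numFieldType) (sc : scalars R K).
Variable X : completeNormedModType K.

(* The Pour-El--Richards axioms for the set S of computable sequences of X.
   Double sequences are computable when they are so after reindexing by the
   pairing function. *)
Record computability_structure (S : set (nat -> X)) : Prop := {
  linear_forms_axiom :
    forall (x y : nat -> X) (al be : nat -> nat -> K) (d : nat -> nat),
      S x -> S y ->
      computable_scalar_seq sc (fun i => al (nfst i) (nsnd i)) ->
      computable_scalar_seq sc (fun i => be (nfst i) (nsnd i)) ->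
      recursive d ->
      S (fun n => \sum_(k < (d n).+1) (al n k *: x k + be n k *: y k));
  limits_axiom :
    forall (x : nat -> nat -> X) (y : nat -> X) (md : nat -> nat),
      S (fun i => x (nfst i) (nsnd i)) ->
      recursive md ->
      (forall n N k, (md (npair n N) <= k)%N ->
         `|x n k - y n| <= 2 ^- N) ->
      S y;
  norms_axiom :
    forall x : nat -> X, S x -> computable_scalar_seq sc (fun n => `|x n|)
}.

Definition computable_elements (S : set (nat -> X)) : set X :=
  [set x | S (fun=> x)].

Definition linear_span (e : nat -> X) : set X :=
  [set x | exists N (c : nat -> K), x = \sum_(i < N) c i *: e i].

Definition rational_span (e : nat -> X) : set X :=
  [set x | exists N (c : nat -> K),
     (forall i, rational_scalars sc (c i)) /\ x = \sum_(i < N) c i *: e i].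

End EffectiveBanach.

Section Numberings.
Variables (K : numFieldType) (X : completeNormedModType K) (a : nat -> X).

(* a_{phi_{e,n}(m)}; only used when phi_{e,n}(m) halts *)
Definition approx (e n m : nat) : X := a (odflt 0%N (phi n e m)).

Definition close (e k n m : nat) : bool :=
  `|approx e n m - approx e n m.-1| < 2 ^- m * k%:R.

(* The position m is eligible at stage n if phi_e(0), ..., phi_e(m) have been
   computed, the consecutive differences up to m obey the bound, and either
   phi_e(m) has just been computed, or phi_e(m+1) has not been computed yet,
   or the next difference violates the bound. *)
Definition eligible (e k n m : nat) : bool :=
  [&& all (halts n e) (iota 0 m.+1),
      all (close e k n) (iota 1 m) &
      [|| [forall n' : 'I_n, ~~ halts n' e m],
          ~~ halts n e m.+1 |
          ~~ close e k n m.+1]].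

(* Some m < n is eligible as soon as phi_{e,n}(0) halts; [find] returns the
   least one. *)
Definition quasi_seq (e k n : nat) : X :=
  if halts n e 0 then approx e n (find (eligible e k n) (iota 0 n)) else a 0%N.

Definition beta (i : nat) : X := lim (quasi_seq (nfst i) (nsnd i) @ \oo).

(* e is in the domain of alpha, and alpha e = x *)
Definition alpha (e : nat) (x : X) : Prop :=
  exists f : nat -> nat,
    [/\ forall n, computes e n (f n),
        (fun m => a (f m)) @ \oo --> x &
        forall n, `|a (f n) - x| < 2 ^- n].

Definition quasi_effective (F : X -> X) : Prop :=
  exists p, forall i, exists j, computes p i j /\ F (beta i) = beta j.

Definition effective (F : X -> X) : Prop :=
  exists p, forall e x, alpha e x -> exists e', computes p e e' /\ alpha e' (F x).

End Numberings.

Definition bounded_linear (K : numFieldType) (X : normedModType K)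
    (F : X -> X) : Prop :=
  linear F /\ exists M : K, forall x, `|F x| <= M * `|x|.

(* Main.v *)
Require Import Defs.
From Stdlib Require Cantor.
From HB Require Import structures.
From mathcomp Require Import all_boot all_order all_algebra.
From mathcomp Require Import complex.
From mathcomp Require Import all_classical all_reals all_analysis.
From mathcomp Require Import zify ring lra.
Set Implicit Arguments.
Unset Strict Implicit.
Unset Printing Implicit Defensive.
Import Order.TTheory GRing.Theory Num.Theory.
Import numFieldNormedType.Exports.
Local Open Scope nat_scope.

(* Let [psi] be a candidate realizer of [F] on beta-indices.  By the recursion
   theorem a program [c] may watch the image [psi <c, k>] of its own beta-index
   before it publishes its next value, and any finite part of the image
   sequence confines its limit to a ball of known radius.

   If [F] sends some [a v] out of the range [A] of [a], fix [w] with [F (a w)]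
   different from [F (a v)].  The image of [a v] is the limit of a sequence that
   does not stop, so sooner or later it shows that it is not [F (a w)]; at this
   moment [c] jumps from [a v] to [a w].  If [F] moves [a 0] and is unbounded on
   [A], then the image of [a 0] must publish a first value, upon which [c] jumps
   from [a 0] to a vector whose image is out of reach.  Diagonalizing against
   [a] gives a computable real [t] with [t *: x] outside [A] for a given nonzero
   [x] in [A], so that scaling by this [t] is never quasi-effective. *)

(** * Programs *)

Lemma nfst_npair x y : nfst (npair x y) = x.
Proof. by rewrite /nfst /npair Cantor.cancel_of_to. Qed.

Lemma nsnd_npair x y : nsnd (npair x y) = y.
Proof. by rewrite /nsnd /npair Cantor.cancel_of_to. Qed.

Definition npairE := (nfst_npair, nsnd_npair).

Lemma npairK z : npair (nfst z) (nsnd z) = z.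
Proof.
rewrite /npair /nfst /nsnd -[RHS]Cantor.cancel_to_of.
by case: (Cantor.of_nat z).
Qed.

Definition compound_code r c := (c * 4 + r).+4.
Definition pair_code f g := compound_code 0 (npair f g).
Definition comp_code f g := compound_code 1 (npair f g).
Definition rec_code f g := compound_code 2 (npair f g).
Definition mu_code f := compound_code 3 f.

Variant program_spec : nat -> Prop :=
  | ZeroProgram : program_spec 0
  | SuccProgram : program_spec 1
  | FstProgram : program_spec 2
  | SndProgram : program_spec 3
  | PairProgram f g : program_spec (pair_code f g)
  | CompProgram f g : program_spec (comp_code f g)
  | RecProgram f g : program_spec (rec_code f g)
  | MuProgram f : program_spec (mu_code f).

Lemma programP e : program_spec e.
Proof.
case: e => [|[|[|[|e]]]]; try by constructor.
rewrite (divn_eq e 4); have : e %% 4 < 4 by rewrite ltn_mod.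
case: (e %% 4) => [|[|[|[|//]]]] _; last exact: MuProgram.
- by rewrite -(npairK (e %/ 4)); exact: PairProgram.
- by rewrite -(npairK (e %/ 4)); exact: CompProgram.
- by rewrite -(npairK (e %/ 4)); exact: RecProgram.
Qed.

Lemma phi_lt n e x y : phi n e x = Some y -> x < n.
Proof. by case: n => //= n; case: ltnP. Qed.

Section PhiUnfold.
Variables n x : nat.
Hypothesis xn : x <= n.

Let compoundE := (modnMDl, modn_small, divnMDl, divn_small, addn0).

Lemma phi_zero : phi n.+1 0 x = Some 0.
Proof. by rewrite /= ltnNge xn. Qed.

Lemma phi_succ : phi n.+1 1 x = Some x.+1.
Proof. by rewrite /= ltnNge xn. Qed.

Lemma phi_nfst : phi n.+1 2 x = Some (nfst x).
Proof. by rewrite /= ltnNge xn. Qed.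

Lemma phi_nsnd : phi n.+1 3 x = Some (nsnd x).
Proof. by rewrite /= ltnNge xn. Qed.

Lemma phi_pair f g : phi n.+1 (pair_code f g) x =
  obind (fun u => omap (npair u) (phi n g x)) (phi n f x).
Proof. by rewrite /= ltnNge xn /= !compoundE// !npairE. Qed.

Lemma phi_comp f g :
  phi n.+1 (comp_code f g) x = obind (phi n f) (phi n g x).
Proof. by rewrite /= ltnNge xn /= !compoundE// !npairE. Qed.

Lemma phi_rec f g : phi n.+1 (rec_code f g) x =
  if nsnd x is m.+1 then
    obind (fun u => phi n g (npair (nfst x) (npair m u)))
          (phi n (rec_code f g) (npair (nfst x) m))
  else phi n f (nfst x).
Proof. by rewrite /= ltnNge xn /= !compoundE// !npairE. Qed.

Lemma phi_mu f : phi n.+1 (mu_code f) x =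
  obind (fun u => if u == 0 then Some (nsnd x)
                  else phi n (mu_code f) (npair (nfst x) (nsnd x).+1))
        (phi n f x).
Proof. by rewrite /= ltnNge xn /= !compoundE. Qed.

End PhiUnfold.

Definition phi_basicE := (phi_zero, phi_succ, phi_nfst, phi_nsnd).

Lemma phi_mono n n' e x y : n <= n' ->
  phi n e x = Some y -> phi n' e x = Some y.
Proof.
elim: n n' e x y => [//|n IH] [//|n'] e x y; rewrite ltnS => nn' E.
have xn : x <= n by rewrite -ltnS (phi_lt E).
have xn' := leq_trans xn nn'; move: E; have {}IH := IH n' _ _ _ nn'.
case: (programP e) => [||||f g|f g|f g|f]; rewrite ?phi_basicE//.
- rewrite !phi_pair//; case Ef: (phi n f x) => [u|] //=.
  by case Eg: (phi n g x) => [v|] //=; rewrite (IH _ _ _ Ef) /= (IH _ _ _ Eg).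
- rewrite !phi_comp//; case Eg: (phi n g x) => [u|] //= /IH.
  by rewrite (IH _ _ _ Eg).
- rewrite !phi_rec//; case: (nsnd x) => [|m]; first exact: IH.
  by case Er: (phi n _ (npair _ m)) => [u|] //= /IH; rewrite (IH _ _ _ Er).
- rewrite !phi_mu//; case Ef: (phi n f x) => [u|] //=.
  by rewrite (IH _ _ _ Ef) /=; case: ifP => // _; exact: IH.
Qed.

Lemma computes_fun e x y y' : computes e x y -> computes e x y' -> y = y'.
Proof.
move=> [n En] [n' En'].
have := phi_mono (leq_maxl n n') En; rewrite (phi_mono (leq_maxr n n') En').
by case.
Qed.

Lemma computes_common_stage b e x y e' x' y' :
    computes e x y -> computes e' x' y' ->
  exists n, [/\ b <= n, phi n e x = Some y & phi n e' x' = Some y'].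
Proof.
move=> [n En] [n' En']; exists (maxn b (maxn n n')); split.
- exact: leq_maxl.
- by apply: phi_mono En; lia.
- by apply: phi_mono En'; lia.
Qed.

Lemma computes_zero x : computes 0 x 0.
Proof. by exists x.+1; rewrite phi_zero. Qed.

Lemma computes_succ x : computes 1 x x.+1.
Proof. by exists x.+1; rewrite phi_succ. Qed.

Lemma computes_nfst x : computes 2 x (nfst x).
Proof. by exists x.+1; rewrite phi_nfst. Qed.

Lemma computes_nsnd x : computes 3 x (nsnd x).
Proof. by exists x.+1; rewrite phi_nsnd. Qed.

Lemma computes_pair f g x u v : computes f x u -> computes g x v ->
  computes (pair_code f g) x (npair u v).
Proof.
move=> fu gv; have [n [xn Ef Eg]] := computes_common_stage x fu gv.
by exists n.+1; rewrite phi_pair// Ef /= Eg.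
Qed.

Lemma computes_id x : computes (pair_code 2 3) x x.
Proof.
rewrite -[X in computes _ _ X]npairK.
exact: computes_pair (computes_nfst x) (computes_nsnd x).
Qed.

Lemma computes_comp f g x u y : computes g x u -> computes f u y ->
  computes (comp_code f g) x y.
Proof.
move=> gu fy; have [n [xn Eg Ef]] := computes_common_stage x gu fy.
by exists n.+1; rewrite phi_comp// Eg.
Qed.

Lemma computes_comp_inv f g x y : computes (comp_code f g) x y ->
  exists2 u, computes g x u & computes f u y.
Proof.
move=> [[//|n] E]; move: (E).
rewrite phi_comp; last by rewrite -ltnS (phi_lt E).
by case Eg: (phi n g x) => [u|] //= Ef; exists u; exists n.
Qed.

Lemma computes_rec0 f g a y : computes f a y ->
  computes (rec_code f g) (npair a 0) y.
Proof.
move=> fy; have [n [xn Ef _]] := computes_common_stage (npair a 0) fy fy.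
by exists n.+1; rewrite phi_rec// !npairE.
Qed.

Lemma computes_recS f g a m u y : computes (rec_code f g) (npair a m) u ->
    computes g (npair a (npair m u)) y ->
  computes (rec_code f g) (npair a m.+1) y.
Proof.
move=> ru gy; have [n [xn Er Eg]] := computes_common_stage (npair a m.+1) ru gy.
by exists n.+1; rewrite phi_rec// !npairE Er.
Qed.

Lemma computes_mu0 f x : computes f x 0 -> computes (mu_code f) x (nsnd x).
Proof.
move=> f0; have [n [xn Ef _]] := computes_common_stage x f0 f0.
by exists n.+1; rewrite phi_mu// Ef.
Qed.

Lemma computes_muS f x u y : computes f x u -> u != 0 ->
    computes (mu_code f) (npair (nfst x) (nsnd x).+1) y ->
  computes (mu_code f) x y.
Proof.
move=> fu u0 muy; have [n [xn Ef Em]] := computes_common_stage x fu muy.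
by exists n.+1; rewrite phi_mu// Ef /= ifN.
Qed.

Lemma computes_mu_inv f a m y : computes (mu_code f) (npair a m) y ->
  computes f (npair a y) 0.
Proof.
move=> [n]; elim: n m => [//|n IH] m E; move: (E).
rewrite phi_mu ?npairE; last by rewrite -ltnS (phi_lt E).
case Ef: (phi n f _) => [u|] //=; case: eqP => [u0 [<-]|_]; last exact: IH.
by exists n; rewrite Ef u0.
Qed.

Lemma computes_mu f (h : nat -> nat) a m d :
    (forall x, computes f (npair a x) (h x)) ->
    (forall x, m <= x < m + d -> h x != 0) -> h (m + d) = 0 ->
  computes (mu_code f) (npair a m) (m + d).
Proof.
move=> fh; elim: d m => [|d IH] m h_neq0 h0.
  rewrite addn0 in h0 *; rewrite -[X in computes _ _ X](nsnd_npair a).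
  by apply: computes_mu0; rewrite -h0.
apply: (computes_muS (fh m)); first by apply: h_neq0; lia.
rewrite !npairE -addSnnS; apply: IH; last by rewrite addSnnS.
by move=> x mx; apply: h_neq0; lia.
Qed.

(** * Recursive functions *)

Lemma recursive_ext f g : f =1 g -> recursive f -> recursive g.
Proof. by move=> fg [e he]; exists e => x; rewrite -fg. Qed.

Lemma recursive_comp f g : recursive f -> recursive g ->
  recursive (fun x => f (g x)).
Proof.
move=> [e he] [e' he']; exists (comp_code e e') => x.
exact: computes_comp (he' x) (he _).
Qed.

Lemma recursive_npair f g : recursive f -> recursive g ->
  recursive (fun x => npair (f x) (g x)).
Proof.
by move=> [e he] [e' he']; exists (pair_code e e') => x; apply: computes_pair.
Qed.

Lemma recursive_succ f : recursive f -> recursive (fun x => (f x).+1).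
Proof. by apply: recursive_comp; exists 1; exact: computes_succ. Qed.

Lemma recursive_nfst : recursive nfst.
Proof. by exists 2; exact: computes_nfst. Qed.

Lemma recursive_nsnd : recursive nsnd.
Proof. by exists 3; exact: computes_nsnd. Qed.

Lemma recursive_id : recursive (fun x => x).
Proof. by exists (pair_code 2 3); exact: computes_id. Qed.

Lemma recursive_cst n : recursive (fun=> n).
Proof.
elim: n => [|n IH]; first by exists 0 => x; exact: computes_zero.
exact: recursive_succ.
Qed.

Definition recursive2 (op : nat -> nat -> nat) :=
  recursive (fun z => op (nfst z) (nsnd z)).

Lemma recursive2_comp op f g : recursive2 op -> recursive f -> recursive g ->
  recursive (fun x => op (f x) (g x)).
Proof.
move=> rop rf rg; have := recursive_comp rop (recursive_npair rf rg).
by apply: recursive_ext => x; rewrite !npairE.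
Qed.

Lemma recursive_primrec2 (h : nat -> nat -> nat) f g :
    recursive f -> recursive g -> (forall a, h a 0 = f a) ->
    (forall a m, h a m.+1 = g (npair a (npair m (h a m)))) ->
  recursive2 h.
Proof.
move=> [e ef] [e' eg] h0 hS; exists (rec_code e e') => z.
rewrite -{1}[z]npairK; elim: (nsnd z) => [|m IH].
  by rewrite h0; apply: computes_rec0.
by rewrite hS; apply: computes_recS IH (eg _).
Qed.

Lemma recursive_primrec (h : nat -> nat) n g : recursive g -> h 0 = n ->
  (forall m, h m.+1 = g (npair m (h m))) -> recursive h.
Proof.
move=> rg h0 hS; have : recursive2 (fun=> h).
  have rg_nsnd := recursive_comp rg recursive_nsnd.
  apply: (recursive_primrec2 (recursive_cst n) rg_nsnd) => // a m.
  by rewrite nsnd_npair.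
by move=> /recursive2_comp/(_ recursive_id recursive_id).
Qed.

Definition recursive_pred (b : nat -> bool) := recursive (fun x => b x : nat).

Create HintDb recursive.
#[global] Hint Resolve recursive_id recursive_cst recursive_nfst
  recursive_nsnd : recursive.

Ltac recur_pred := fail.

Ltac recur :=
  first [assumption | by auto with recursive nocore |
  lazymatch goal with
  | |- recursive (fun x => S (@?f x)) => apply: (@recursive_succ f); recur
  | |- recursive (fun x => npair (@?f x) (@?g x)) =>
      apply: (@recursive_npair f g); recur
  | |- recursive (fun x => ?op (@?f x) (@?g x)) =>
      apply: (@recursive2_comp op f g);
      [by auto with recursive nocore | recur | recur]
  | |- recursive (fun x => ?op (@?f x)) =>
      apply: (@recursive_comp op f); [by auto with recursive nocore | recur]
  | _ => recur_pred
  end].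

Lemma recursive_addn : recursive2 addn.
Proof.
apply: (@recursive_primrec2 _ (fun x => x) (fun z => (nsnd (nsnd z)).+1));
  [recur|recur|exact: addn0|].
by move=> a m; rewrite !npairE addnS.
Qed.
#[global] Hint Resolve recursive_addn : recursive.

Lemma recursive_muln : recursive2 muln.
Proof.
apply: (@recursive_primrec2 _ (fun=> 0) (fun z => nsnd (nsnd z) + nfst z));
  [recur|recur|exact: muln0|].
by move=> a m; rewrite !npairE mulnS addnC.
Qed.
#[global] Hint Resolve recursive_muln : recursive.

Lemma recursive_expn : recursive2 expn.
Proof.
apply: (@recursive_primrec2 _ (fun=> 1) (fun z => nsnd (nsnd z) * nfst z));
  [recur|recur|exact: expn0|].
by move=> a m; rewrite !npairE expnSr.
Qed.
#[global] Hint Resolve recursive_expn : recursive.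

Lemma recursive_predn : recursive predn.
Proof.
by apply: (@recursive_primrec _ 0 nfst) => // [|m]; [recur|rewrite npairE].
Qed.
#[global] Hint Resolve recursive_predn : recursive.

Lemma recursive_subn : recursive2 subn.
Proof.
apply: (@recursive_primrec2 _ (fun x => x) (fun z => (nsnd (nsnd z)).-1));
  [recur|recur|exact: subn0|].
by move=> a m; rewrite !npairE subnS.
Qed.
#[global] Hint Resolve recursive_subn : recursive.

Section RecursivePredicates.
Variables (f g : nat -> nat) (b c : nat -> bool).
Hypotheses (rf : recursive f) (rg : recursive g).
Hypotheses (rb : recursive_pred b) (rc : recursive_pred c).

Lemma recursive_eq0 : recursive_pred (fun x => f x == 0).
Proof.
have : recursive (fun x => 1 - f x) by recur.
by apply: recursive_ext => x; case: (f x).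
Qed.

Lemma recursive_negb : recursive_pred (fun x => ~~ b x).
Proof.
have : recursive (fun x => 1 - b x) by recur.
by apply: recursive_ext => x; case: (b x).
Qed.

Lemma recursive_andb : recursive_pred (fun x => b x && c x).
Proof.
have : recursive (fun x => (b x : nat) * (c x : nat)) by recur.
by apply: recursive_ext => x; case: (b x); case: (c x).
Qed.

Lemma recursive_if : recursive (fun x => if b x then f x else g x).
Proof.
have : recursive (fun x => (b x : nat) * f x + (1 - b x) * g x) by recur.
by apply: recursive_ext => x; case: (b x) => /=; lia.
Qed.

End RecursivePredicates.

Lemma recursive_leq f g : recursive f -> recursive g ->
  recursive_pred (fun x => f x <= g x).
Proof.
by move=> rf rg; apply: (recursive_eq0 (f := fun x => f x - g x)); recur.
Qed.

Lemma recursive_eqn f g : recursive f -> recursive g ->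
  recursive_pred (fun x => f x == g x).
Proof.
move=> rf rg.
have := recursive_andb (recursive_leq rf rg) (recursive_leq rg rf).
by apply: recursive_ext => x; rewrite eqn_leq.
Qed.

Lemma recursive_orb b c : recursive_pred b -> recursive_pred c ->
  recursive_pred (fun x => b x || c x).
Proof.
move=> /recursive_negb rNb /recursive_negb rNc.
have := recursive_negb (recursive_andb rNb rNc).
by apply: recursive_ext => x; rewrite negb_and !negbK.
Qed.

Lemma recursive_pred_comp b f : recursive_pred b -> recursive f ->
  recursive_pred (fun x => b (f x)).
Proof. exact: recursive_comp. Qed.

Ltac recur_pred ::=
  lazymatch goal with
  | |- recursive_pred (fun x => leq (@?f x) (@?g x)) =>
      apply: (@recursive_leq f g); recur
  | |- recursive_pred (fun x => eq_op (@?f x) (@?g x)) =>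
      apply: (@recursive_eqn f g); recur
  | |- recursive_pred (fun x => ~~ @?b x) => apply: (@recursive_negb b); recur
  | |- recursive_pred (fun x => @?b x && @?c x) =>
      apply: (@recursive_andb b c); recur
  | |- recursive_pred (fun x => @?b x || @?c x) =>
      apply: (@recursive_orb b c); recur
  | |- recursive _ => apply: recursive_if; recur
  end.

Lemma recursive_odd : recursive_pred odd.
Proof.
apply: (@recursive_primrec _ 0 (fun z => 1 - nsnd z)) => // [|m].
  by recur.
by rewrite npairE oddS; case: (odd m).
Qed.

Definition lookup T l := nfst (iter l nsnd T).

Lemma recursive_lookup : recursive2 lookup.
Proof.
have rtail : recursive2 (fun T l => iter l nsnd T).
  apply: (@recursive_primrec2 _ (fun x => x) (fun z => nsnd (nsnd (nsnd z))));
    [recur|recur|by []|].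
  by move=> a m; rewrite !npairE.
exact: recursive_comp recursive_nfst rtail.
Qed.
#[global] Hint Resolve recursive_lookup : recursive.

Lemma lookup_onto m (t : nat -> nat) :
  exists T, forall l, l < m -> lookup T l = t l.
Proof.
elim: m t => [|m IH] t; first by exists 0.
have [T hT] := IH (fun l => t l.+1); exists (npair (t 0) T) => -[_|l lm].
  by rewrite /lookup npairE.
by rewrite /lookup iterSr npairE; exact: hT.
Qed.

(** * Semidecidable relations *)

Definition sigma1 (P : nat -> Prop) :=
  exists2 g, recursive g & forall x, P x <-> exists t, g (npair x t) = 0.

Definition sigma1_rel (P : nat -> nat -> Prop) :=
  sigma1 (fun z => P (nfst z) (nsnd z)).

Lemma sigma1_ext P Q : (forall x, P x <-> Q x) -> sigma1 P -> sigma1 Q.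
Proof. by move=> PQ [g rg gP]; exists g => // x; rewrite -PQ. Qed.

Lemma sigma1_comp P f : sigma1 P -> recursive f -> sigma1 (fun x => P (f x)).
Proof.
move=> [g rg gP] rf; exists (fun z => g (npair (f (nfst z)) (nsnd z))).
  by recur.
move=> x; rewrite gP.
by split=> -[t gt]; exists t; move: gt; rewrite !npairE.
Qed.

Lemma sigma1_recursive b : recursive_pred b -> sigma1 b.
Proof.
move=> rb; exists (fun z => ~~ b (nfst z)).
  by have := recursive_negb (recursive_pred_comp rb recursive_nfst).
move=> x; split=> [bx|[t]]; first by exists 0; rewrite npairE bx.
by rewrite npairE; case: (b x).
Qed.

Lemma sigma1_and P Q : sigma1 P -> sigma1 Q -> sigma1 (fun x => P x /\ Q x).
Proof.
move=> [g rg gP] [h rh hQ].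
exists (fun z => g (npair (nfst z) (nfst (nsnd z))) +
                 h (npair (nfst z) (nsnd (nsnd z)))); first by recur.
move=> x; rewrite gP hQ; split=> [[[t gt] [s hs]]|[t]].
  by exists (npair t s); rewrite !npairE gt hs.
by rewrite !npairE => ts; split; [exists (nfst t)|exists (nsnd t)]; lia.
Qed.

Lemma sigma1_and3 P Q T : sigma1 P -> sigma1 Q -> sigma1 T ->
  sigma1 (fun x => [/\ P x, Q x & T x]).
Proof.
move=> sP sQ sT; apply: sigma1_ext (sigma1_and sP (sigma1_and sQ sT)) => x.
by split=> [[? []]|[]].
Qed.

Lemma sigma1_or P Q : sigma1 P -> sigma1 Q -> sigma1 (fun x => P x \/ Q x).
Proof.
move=> [g rg gP] [h rh hQ].
exists (fun z => g z * h z); first by recur.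
move=> x; rewrite gP hQ; split=> [[[t gt]|[t ht]]|[t]].
- by exists t; rewrite gt.
- by exists t; rewrite ht muln0.
- by move/eqP; rewrite muln_eq0 => /orP[]/eqP ht; [left|right]; exists t.
Qed.

Lemma sigma1_ex P : sigma1_rel P -> sigma1 (fun x => exists y, P x y).
Proof.
move=> [g rg gP]; exists (fun z => g (npair (npair (nfst z) (nfst (nsnd z)))
  (nsnd (nsnd z)))); first by recur.
move=> x; split=> [[y Pxy]|[t]].
  have /gP[t gt] : P (nfst (npair x y)) (nsnd (npair x y)) by rewrite !npairE.
  by exists (npair y t); rewrite !npairE.
rewrite !npairE => gt; exists (nfst t).
by have := (gP (npair x (nfst t))).2 (ex_intro _ _ gt); rewrite !npairE.
Qed.

(* The witnesses for all [l < m x] are collected in one table. *)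
Lemma sigma1_bounded_forall (m : nat -> nat) P : recursive m -> sigma1_rel P ->
  sigma1 (fun x => forall l, l < m x -> P x l).
Proof.
move=> rm [g rg gP].
have PE x l : P x l <-> exists t, g (npair (npair x l) t) = 0.
  by rewrite -gP !npairE.
pose s z k := \sum_(l < k) g (npair (npair (nfst z) l) (lookup (nsnd z) l)).
have rs : recursive2 s.
  apply: (@recursive_primrec2 _ (fun=> 0) (fun z => nsnd (nsnd z) +
    g (npair (npair (nfst (nfst z)) (nfst (nsnd z)))
             (lookup (nsnd (nfst z)) (nfst (nsnd z)))))); [recur|recur| |].
    by move=> a; rewrite /s big_ord0.
  by move=> a k; rewrite /s big_ord_recr /= !npairE.
exists (fun z => s z (m (nfst z))); first by apply: (recursive2_comp rs); recur.
move=> x; split=> [Px|[T]].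
  have /choice[t gt] l : exists t, l < m x -> g (npair (npair x l) t) = 0.
    case: (ltnP l (m x)) => [/Px/PE[t gt]|_]; last by exists 0.
    by exists t.
  have [T Tt] := lookup_onto (m x) t; exists T.
  by rewrite /s !npairE big1// => l _; rewrite Tt//; exact: gt.
rewrite /s !npairE => /eqP; rewrite sum_nat_eq0 => /forallP s0 l lm.
by apply/PE; exists (lookup T l); apply/eqP; exact: (s0 (Ordinal lm)).
Qed.

(* [q] is a partial recursive choice function for [P]. *)
Definition uniformizes q (P : nat -> nat -> Prop) := forall x,
  (forall y, computes q x y -> P x y) /\
  ((exists y, P x y) -> exists y, computes q x y).

Lemma uniformizes_det q P x y : uniformizes q P -> P x y ->
  (forall z, P x z -> z = y) -> computes q x y.
Proof.
move=> qP Pxy Px; have [z qz] := (qP x).2 (ex_intro _ y Pxy).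
by rewrite -(Px z ((qP x).1 z qz)).
Qed.

Lemma recursive_uniformizes g : recursive g ->
  exists q, uniformizes q (fun x y => g (npair x y) = 0).
Proof.
move=> [c gc].
have c0 x : computes (pair_code (pair_code 2 3) 0) x (npair x 0).
  exact: computes_pair (computes_id x) (computes_zero x).
exists (comp_code (mu_code c) (pair_code (pair_code 2 3) 0)) => x; split=> [y|].
  case/computes_comp_inv => u /(computes_fun (c0 x)) <- /computes_mu_inv.
  exact: computes_fun (gc _).
move=> gx; have gx' : exists y, g (npair x y) == 0.
  by have [y /eqP] := gx; exists y.
case: (ex_minnP gx') => y /eqP gy0 ymin; exists y.
apply: computes_comp (c0 x) _; rewrite -[y]add0n.
apply: (computes_mu (h := fun t => g (npair x t))) => [t //|t ty|//].
by apply/negP => /ymin; lia.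
Qed.

Lemma sigma1_uniformizes P : sigma1_rel P -> exists q, uniformizes q P.
Proof.
move=> [g rg gP].
have PE x y : P x y <-> exists t, g (npair (npair x y) t) = 0.
  by rewrite -gP !npairE.
have [|q qg] := @recursive_uniformizes (fun z =>
  g (npair (npair (nfst z) (nfst (nsnd z))) (nsnd (nsnd z)))); first by recur.
exists (comp_code 2 q) => x; have [gq qex] := qg x; split=> [y|[y]].
  case/computes_comp_inv => u /gq; rewrite !npairE => gu.
  move/(computes_fun (computes_nfst u)) => <-.
  by apply/PE; exists (nsnd u).
move=> /PE[t gt]; have [|u qu] := qex.
  by exists (npair y t); rewrite !npairE.
by exists (nfst u); apply: computes_comp qu (computes_nfst u).
Qed.

Lemma sigma1_choice P : sigma1_rel P -> (forall x, exists y, P x y) ->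
  exists2 f, recursive f & forall x, P x (f x).
Proof.
move=> /sigma1_uniformizes[q qP] Pex.
have /choice[f qf] : forall x, exists y, computes q x y.
  by move=> x; apply: (qP x).2.
by exists f; [exists q|move=> x; apply: (qP x).1].
Qed.

(** * The universal relation *)

Section InductiveSets.
Variables (base : nat -> Prop) (rule : nat -> nat -> nat -> Prop).

Inductive deducible : nat -> Prop :=
  | deducible_base z of base z : deducible z
  | deducible_rule p q z of deducible p & deducible q & rule p q z :
      deducible z.

(* Premises follow their conclusions, so that a conclusion is added in front. *)
Definition deduction (t : nat -> nat) m := forall l, l < m ->
  base (t l) \/
  exists i j, [/\ l < i < m, l < j < m & rule (t i) (t j) (t l)].

Lemma deduction_deducible t m l : deduction t m -> l < m -> deducible (t l).
Proof.
move=> dt; have [k] := ubnP (m - l); elim: k l => // k IH l mlk lm.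
have [/deducible_base //|[i [j [li lj tl]]]] := dt l lm.
by apply: deducible_rule tl; apply: IH; lia.
Qed.

Lemma deduction_cat s s' : deduction (nth 0 s) (size s) ->
    deduction (nth 0 s') (size s') ->
  deduction (nth 0 (s ++ s')) (size (s ++ s')).
Proof.
move=> ds ds' l; rewrite size_cat nth_cat.
have [ls _|sl ll] := ltnP l (size s).
  have [?|[i [j [/andP[li il] /andP[lj jl] sl]]]] := ds l ls; [by left|right].
  by exists i, j; rewrite !nth_cat il jl; split=> //; lia.
have [|?|[i [j [li lj s'l]]]] := ds' (l - size s); [lia|by left|right].
exists (size s + i), (size s + j); rewrite !nth_cat.
by rewrite !ltnNge !leq_addr /= !addKn; split=> //; lia.
Qed.

Lemma deducible_deduction z : deducible z ->
  exists s, deduction (nth 0 (z :: s)) (size s).+1.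
Proof.
elim=> {z} [z bz|p q z _ [s ds] _ [s' ds'] pqz].
  by exists [::] => -[|//] _; left.
exists ((p :: s) ++ (q :: s')) => -[_|l ls].
  right; exists 1, (size s).+2; rewrite size_cat /=.
  by rewrite nth_cat ltnn subnn; split=> //; lia.
have [?|[i [j [li lj sl]]]] := deduction_cat ds ds' ls; [by left|right].
by exists i.+1, j.+1.
Qed.

Lemma sigma1_deducible : sigma1 base ->
    sigma1 (fun w => rule (nfst w) (nfst (nsnd w)) (nsnd (nsnd w))) ->
  sigma1 deducible.
Proof.
move=> sbase srule.
have srule_comp f g h : recursive f -> recursive g -> recursive h ->
    sigma1 (fun x => rule (f x) (g x) (h x)).
  move=> rf rg rh; have rfgh := recursive_npair rf (recursive_npair rg rh).
  by apply: sigma1_ext (sigma1_comp srule rfgh) => x; rewrite !npairE.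
have : sigma1 (fun z => exists m T,
    lookup T 0 == z /\ deduction (lookup T) m.+1).
  apply: sigma1_ex; apply: sigma1_ex; apply: sigma1_and.
    by apply: sigma1_recursive; recur.
  apply: sigma1_bounded_forall; first by recur.
  apply: sigma1_or; first by apply: (sigma1_comp sbase); recur.
  apply: sigma1_ex; apply: sigma1_ex; apply: sigma1_and3.
  - by apply: sigma1_recursive; recur.
  - by apply: sigma1_recursive; recur.
  - by apply: srule_comp; recur.
apply: sigma1_ext => z; split=> [[m [T [/eqP <- dT]]]|].
  exact: deduction_deducible dT _.
case/deducible_deduction => s ds; exists (size s).
have [T Ts] := lookup_onto (size s).+1 (nth 0 (z :: s)).
exists T; rewrite Ts//; split=> // l ls; have := ds l ls; rewrite !Ts//.
case=> [?|[i [j [li lj sl]]]]; [by left|right; exists i, j; split=> //].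
by rewrite !Ts//; lia.
Qed.

End InductiveSets.

(* [claim e x y] codes the assertion phi_e(x) = y. *)
Definition claim e x y := npair e (npair x y).
Definition claim_code z := nfst z.
Definition claim_arg z := nfst (nsnd z).
Definition claim_val z := nsnd (nsnd z).

Lemma claim_codeE e x y : claim_code (claim e x y) = e.
Proof. by rewrite /claim_code npairE. Qed.

Lemma claim_argE e x y : claim_arg (claim e x y) = x.
Proof. by rewrite /claim_arg !npairE. Qed.

Lemma claim_valE e x y : claim_val (claim e x y) = y.
Proof. by rewrite /claim_val !npairE. Qed.

Definition claimE := (claim_codeE, claim_argE, claim_valE).

Lemma recursive_claim_code : recursive claim_code.
Proof. exact: recursive_nfst. Qed.

Lemma recursive_claim_arg : recursive claim_arg.
Proof. exact: recursive_comp recursive_nfst recursive_nsnd. Qed.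

Lemma recursive_claim_val : recursive claim_val.
Proof. exact: recursive_comp recursive_nsnd recursive_nsnd. Qed.
#[global] Hint Resolve recursive_claim_code recursive_claim_arg
  recursive_claim_val : recursive.

Lemma recursive_compound_code r f :
  recursive f -> recursive (fun x => compound_code r (f x)).
Proof. by move=> rf; rewrite /compound_code; recur. Qed.

Lemma recursive_pair_code : recursive2 pair_code.
Proof. by apply: recursive_compound_code; recur. Qed.

Lemma recursive_comp_code : recursive2 comp_code.
Proof. by apply: recursive_compound_code; recur. Qed.

Lemma recursive_rec_code : recursive2 rec_code.
Proof. by apply: recursive_compound_code; recur. Qed.

Lemma recursive_mu_code : recursive mu_code.
Proof. by apply: recursive_compound_code; recur. Qed.
#[global] Hint Resolve recursive_pair_code recursive_comp_code
  recursive_rec_code recursive_mu_code : recursive.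

Definition basic_claim z :=
  [|| (claim_code z == 0) && (claim_val z == 0),
      (claim_code z == 1) && (claim_val z == (claim_arg z).+1),
      (claim_code z == 2) && (claim_val z == nfst (claim_arg z)) |
      (claim_code z == 3) && (claim_val z == nsnd (claim_arg z))].

(* One alternative for each clause of [phi]; [w] is the step function of the
   primitive recursion, which does not occur in the premise of its base case. *)
Definition phi_rule w p q z :=
  let e := claim_code p in let x := claim_arg p in let y := claim_val p in
  let e' := claim_code q in let x' := claim_arg q in let y' := claim_val q in
  [|| (x' == x) && (z == claim (pair_code e e') x (npair y y')),
      (x' == y) && (z == claim (comp_code e' e) x y'),
      z == claim (rec_code e w) (npair x 0) y,
      [&& e == rec_code w e', x' == npair (nfst x) (npair (nsnd x) y) &
          z == claim e (npair (nfst x) (nsnd x).+1) y'],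
      (y == 0) && (z == claim (mu_code e) x (nsnd x)) |
      [&& y != 0, e' == mu_code e, x' == npair (nfst x) (nsnd x).+1 &
          z == claim e' x y']].

Definition phi_deducible := deducible (fun z => basic_claim z)
  (fun p q z => exists w, phi_rule w p q z).

Lemma basic_claim_sound z : basic_claim z ->
  computes (claim_code z) (claim_arg z) (claim_val z).
Proof.
case/or4P => /andP[/eqP-> /eqP->].
- exact: computes_zero.
- exact: computes_succ.
- exact: computes_nfst.
- exact: computes_nsnd.
Qed.

Lemma phi_deducible_sound z : phi_deducible z ->
  computes (claim_code z) (claim_arg z) (claim_val z).
Proof.
elim=> {z} [z /basic_claim_sound //|p q z _ cp _ cq [w]].
rewrite /phi_rule.
move: cp cq; move: (claim_code p) (claim_arg p) (claim_val p) => e x y.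
move: (claim_code q) (claim_arg q) (claim_val q) => e' x' y' cp cq.
case/or4P => [||/eqP->|/or3P[]]; rewrite ?claimE.
- case/andP=> /eqP xE /eqP->; rewrite !claimE; apply: computes_pair => //.
  by rewrite -xE.
- case/andP=> /eqP xE /eqP->; rewrite !claimE; apply: computes_comp cp _.
  by rewrite -xE.
- exact: computes_rec0.
- case/and3P=> /eqP eE /eqP xE /eqP->; rewrite !claimE eE.
  by apply: (@computes_recS _ _ _ _ y); rewrite -?eE ?npairK -?xE.
- case/andP=> /eqP yE /eqP->; rewrite !claimE.
  by apply: computes_mu0; rewrite -yE.
- case/and4P=> y0 /eqP eE /eqP xE /eqP->; rewrite !claimE eE.
  by apply: computes_muS cp y0 _; rewrite -eE -xE.
Qed.

Lemma phi_deducible_complete n e x y :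
  phi n e x = Some y -> phi_deducible (claim e x y).
Proof.
elim: n e x y => [//|n IH] e x y E.
have xn : x <= n by rewrite -ltnS (phi_lt E).
have basic : basic_claim (claim e x y) -> phi_deducible (claim e x y).
  exact: deducible_base.
have step w p q z : phi_rule w p q z -> phi_deducible p -> phi_deducible q ->
    phi_deducible z.
  by move=> pqz dp dq; apply: deducible_rule dp dq _; exists w.
rewrite /basic_claim !claimE in basic.
move: E basic; case: (programP e) => [||||f g|f g|f g|f].
- by rewrite phi_zero// => -[<-]; apply.
- by rewrite phi_succ// => -[<-] /=; rewrite eqxx; apply.
- by rewrite phi_nfst// => -[<-] /=; rewrite eqxx; apply.
- by rewrite phi_nsnd// => -[<-] /=; rewrite eqxx; apply.
- rewrite phi_pair//; case Ef: (phi n f x) => [u|] //=.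
  case Eg: (phi n g x) => [v|] //= -[<-] _.
  apply: (step 0 _ _ _ _ (IH _ _ _ Ef) (IH _ _ _ Eg)).
  by rewrite /phi_rule !claimE !eqxx.
- rewrite phi_comp//; case Eg: (phi n g x) => [u|] //= Ef _.
  apply: (step 0 _ _ _ _ (IH _ _ _ Eg) (IH _ _ _ Ef)).
  by rewrite /phi_rule !claimE !eqxx /= ?orbT.
- rewrite phi_rec// -[in claim _ x](npairK x); case: (nsnd x) => [|m].
    move=> Ef _; apply: (step g _ _ _ _ (IH _ _ _ Ef) (IH _ _ _ Ef)).
    by rewrite /phi_rule !claimE !eqxx /= ?orbT.
  case Er: (phi n _ (npair _ m)) => [u|] //= Eg _.
  apply: (step f _ _ _ _ (IH _ _ _ Er) (IH _ _ _ Eg)).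
  by rewrite /phi_rule !claimE !npairE !eqxx /= ?orbT.
- rewrite phi_mu//; case Ef: (phi n f x) => [u|] //=.
  case: eqP => [u0 [<-] _|/eqP u0 Em _].
    apply: (step 0 _ _ _ _ (IH _ _ _ Ef) (IH _ _ _ Ef)).
    by rewrite /phi_rule !claimE u0 !eqxx /= ?orbT.
  apply: (step 0 _ _ _ _ (IH _ _ _ Ef) (IH _ _ _ Em)).
  by rewrite /phi_rule !claimE u0 !eqxx /= ?orbT.
Qed.

Lemma computes_deducible e x y :
  computes e x y <-> phi_deducible (claim e x y).
Proof.
split=> [[n]|/phi_deducible_sound]; first exact: phi_deducible_complete.
by rewrite !claimE.
Qed.

Lemma sigma1_computes e x y : recursive e -> recursive x -> recursive y ->
  sigma1 (fun z => computes (e z) (x z) (y z)).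
Proof.
move=> re rx ry; have sd : sigma1 phi_deducible.
  apply: sigma1_deducible; rewrite /basic_claim /phi_rule /claim /=.
    by apply: sigma1_recursive; recur.
  by apply: sigma1_ex; apply: sigma1_recursive; recur.
have := sigma1_comp sd (recursive_npair re (recursive_npair rx ry)).
by apply: sigma1_ext => z; rewrite computes_deducible.
Qed.

(** * The recursion theorem *)

Fixpoint cst_code v := if v is v'.+1 then comp_code 1 (cst_code v') else 0.

Lemma computes_cst v x : computes (cst_code v) x v.
Proof.
elim: v => [|v IH]; first exact: computes_zero.
exact: computes_comp IH (computes_succ v).
Qed.

Lemma recursive_cst_code : recursive cst_code.
Proof.
by apply: (@recursive_primrec _ 0 (fun z => comp_code 1 (nsnd z))) => // [|m];
  [recur|rewrite npairE].
Qed.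
#[global] Hint Resolve recursive_cst_code : recursive.

Definition smn u v := comp_code u (pair_code (cst_code v) (pair_code 2 3)).

Lemma recursive_smn : recursive2 smn.
Proof. by rewrite /recursive2 /smn; recur. Qed.
#[global] Hint Resolve recursive_smn : recursive.

Lemma computes_smn u v x y :
  computes (smn u v) x y <-> computes u (npair v x) y.
Proof.
have vx : computes (pair_code (cst_code v) (pair_code 2 3)) x (npair v x).
  exact: computes_pair (computes_cst v x) (computes_id x).
split; last exact: computes_comp.
by case/computes_comp_inv => w /(computes_fun vx) <-.
Qed.

(* Kleene's recursion theorem, for the program that searches for a [y] with
   [P e x y], where [e] is its own index. *)
Lemma recursion_theorem (P : nat -> nat -> nat -> Prop) :
    sigma1 (fun z => P (nfst (nfst z)) (nsnd (nfst z)) (nsnd z)) ->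
  exists e, uniformizes e (P e).
Proof.
move=> sP; pose Q z y := P (smn (nfst z) (nfst z)) (nsnd z) y.
have [|q qQ] := @sigma1_uniformizes Q.
  have /(sigma1_comp sP) : recursive (fun w => npair (npair
      (smn (nfst (nfst w)) (nfst (nfst w))) (nsnd (nfst w))) (nsnd w)).
    by recur.
  by apply: sigma1_ext => w; rewrite !npairE.
exists (smn q q) => x; have := qQ (npair q x); rewrite /Q !npairE => -[hP Pex].
split=> [y /computes_smn /hP//|/Pex[y qy]].
by exists y; apply/computes_smn.
Qed.

(** * Computable reals *)

Local Open Scope classical_set_scope.
Local Open Scope ring_scope.

Lemma computable_rat_seqP r : computable_rat_seq r <->
  exists p m q : nat -> nat, [/\ recursive p, recursive m, recursive q &
    forall n, q n != 0%N /\ r n = ((p n)%:R - (m n)%:R) / (q n)%:R].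
Proof.
split=> [[s [p [q [rs rp rq rE]]]]|[p [m [q [rp rm rq rE]]]]].
  have r_odd : recursive_pred (fun n => odd (s n)).
    exact: recursive_pred_comp recursive_odd rs.
  exists (fun n => if odd (s n) then 0%N else p n).
  exists (fun n => if odd (s n) then p n else 0%N), q; split; [recur..|] => n.
  have [q0 ->] := rE n; split=> //; rewrite -signr_odd.
  by case: (odd (s n)); rewrite ?expr1 ?sub0r ?mulN1r// expr0 subr0 mul1r.
exists (fun n => if (p n < m n)%N then 1%N else 0%N).
exists (fun n => (p n - m n) + (m n - p n))%N, q; split; [recur..|] => n.
have [q0 ->] := rE n; split=> //; have [lt_pm|le_mp] := ltnP (p n) (m n).
  have /eqP-> : (p n - m n == 0)%N by rewrite subn_eq0 ltnW.
  by rewrite expr1 mulN1r add0n (natrB _ (ltnW lt_pm)) opprB.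
have /eqP-> : (m n - p n == 0)%N by rewrite subn_eq0.
by rewrite expr0 mul1r addn0 natrB.
Qed.

Lemma computable_rat_frac p q : recursive p -> recursive q ->
  (forall n, q n != 0)%N -> computable_rat_seq (fun n => (p n)%:R / (q n)%:R).
Proof.
move=> rp rq q0; exists (fun=> 0%N), p, q.
by split=> // [|n]; [recur|rewrite expr0 mul1r].
Qed.

Lemma computable_rat_adic b p m : recursive p -> recursive m ->
  computable_rat_seq (fun n => (p n)%:R / (b.+1 ^ m n)%:R).
Proof.
move=> rp rm; apply: (computable_rat_frac (q := fun n => b.+1 ^ m n)%N) => //.
  by recur.
by move=> n; rewrite expn_eq0.
Qed.

Lemma computable_rat_cst (c : rat) : computable_rat_seq (fun=> c).
Proof.
exists (fun=> (numq c < 0)%R : nat), (fun=> `|numq c|%N), (fun=> `|denq c|%N).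
split; [recur..|] => n; rewrite absz_eq0 denq_neq0; split=> //.
rewrite -[LHS]divq_num_den {1}[numq c]intEsign.
rewrite -{1}[denq c]gez0_abs ?denq_ge0//.
by rewrite rmorphM rmorph_sign.
Qed.

Lemma computable_ratD r r' : computable_rat_seq r -> computable_rat_seq r' ->
  computable_rat_seq (fun n => r n + r' n).
Proof.
move=> /computable_rat_seqP[p [m [q [rp rm rq rE]]]].
move=> /computable_rat_seqP[p' [m' [q' [rp' rm' rq' rE']]]].
apply/computable_rat_seqP; exists (fun n => p n * q' n + p' n * q n)%N.
exists (fun n => m n * q' n + m' n * q n)%N, (fun n => q n * q' n)%N.
split; [recur..|] => n; have [q0 ->] := rE n; have [q0' ->] := rE' n.
rewrite muln_eq0 (negPf q0) (negPf q0'); split=> //.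
by rewrite !natrD !natrM; field; rewrite !pnatr_eq0 q0 q0'.
Qed.

Lemma recursive_ltr_rat r r' : computable_rat_seq r -> computable_rat_seq r' ->
  recursive_pred (fun n => r n < r' n).
Proof.
move=> /computable_rat_seqP[p [m [q [rp rm rq rE]]]].
move=> /computable_rat_seqP[p' [m' [q' [rp' rm' rq' rE']]]].
have : recursive_pred (fun n =>
    p n * q' n + m' n * q n < p' n * q n + m n * q' n)%N by recur.
apply: recursive_ext => n; congr nat_of_bool.
have [q0 ->] := rE n; have [q0' ->] := rE' n.
rewrite ltr_pdivrMr ?ltr0n ?lt0n// mulrAC ltr_pdivlMr ?ltr0n ?lt0n//.
rewrite -(ltr_nat rat) !natrD !natrM !mulrBl ltrBlDr addrAC ltrBrDr.
by congr (_ < _); ring.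
Qed.

Lemma computable_rat_comp r f : computable_rat_seq r -> recursive f ->
  computable_rat_seq (fun n => r (f n)).
Proof.
move=> [s [p [q [rs rp rq rE]]]] rf.
exists (s \o f), (p \o f), (q \o f).
by split=> [|||n]; [exact: recursive_comp..|exact: rE].
Qed.

Lemma computable_rat_if b r r' : recursive_pred b -> computable_rat_seq r ->
    computable_rat_seq r' ->
  computable_rat_seq (fun n => if b n then r n else r' n).
Proof.
move=> rb [s [p [q [rs rp rq rE]]]] [s' [p' [q' [rs' rp' rq' rE']]]].
exists (fun n => if b n then s n else s' n).
exists (fun n => if b n then p n else p' n).
exists (fun n => if b n then q n else q' n); split; [recur..|] => n.
by case: (b n).
Qed.

Lemma ler_dist_telescope (K : numDomainType) (V : normedZmodType K)
    (x : nat -> V) (d : nat -> K) (m p : nat) : (m <= p)%N ->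
    (forall l, (m <= l < p)%N -> `|x l.+1 - x l| <= d l - d l.+1) ->
  `|x p - x m| <= d m - d p.
Proof.
move=> mp xd; rewrite -telescope_sumr// -opprB -telescope_sumr// -sumrN.
apply: le_trans (ler_norm_sum _ _ _) _; apply: ler_sum_nat => l /xd.
by rewrite opprB.
Qed.

Lemma archimedean_exp2V (K : numFieldType) (eps : K) (k : nat) :
    Num.archimedean_axiom K -> 0 < eps ->
  exists m : nat, 2 ^- m * k%:R < eps.
Proof.
move=> archK eps0; have [->|k0] := posnP k; first by exists 0%N; rewrite mulr0.
have [N] := archK (k%:R / eps); rewrite ger0_norm ?divr_ge0 ?ler0n ?ltW//.
rewrite ltr_pdivrMr// => kN; exists N.
rewrite mulrC ltr_pdivrMr ?exprn_gt0//; apply: lt_trans kN _.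
by rewrite mulrC ltr_pM2l// -natrX ltr_nat ltn_expl.
Qed.

Section ComputableReals.
Variable R : realType.
Implicit Types (x y : nat -> R) (c : R) (r : nat -> rat).

Lemma telescope_limit x (d : nat -> R) : (forall n, 0 <= d n) ->
    (forall n, `|x n.+1 - x n| <= d n - d n.+1) ->
  exists c, forall n, `|x n - c| <= d n.
Proof.
move=> d0 xd.
have bounds n m : x n - d n <= x m + d m.
  have [mn|/ltnW nm] := leqP m n.
    have := ler_dist_telescope mn (fun l _ => xd l); rewrite ler_distl.
    by have := d0 n; lra.
  have := ler_dist_telescope nm (fun l _ => xd l); rewrite ler_distl.
  by have := d0 m; lra.
pose U := range (fun n => x n - d n).
exists (sup U) => n; rewrite ler_distlC; apply/andP; split.
  apply: ub_le_sup; last by exists n.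
  by exists (x 0%N + d 0%N) => _ [m _ <-]; exact: bounds.
by apply: ge_sup => [|_ [m _ <-]]; [exists (x 0%N - d 0%N), 0%N|exact: bounds].
Qed.

Lemma archimedean_real : Num.archimedean_axiom R.
Proof. by move=> x; exists (Num.truncn `|x|).+1; rewrite truncnS_gt. Qed.

Lemma exp2V_small (eps : R) : 0 < eps -> exists k : nat, 2 ^- k < eps.
Proof.
move=> eps0; have [m] := archimedean_exp2V 1 archimedean_real eps0.
by rewrite mulr1; exists m.
Qed.

Lemma computable_real_ratr r : computable_rat_seq r ->
  computable_real_seq (fun n => ratr (r n) : R).
Proof.
move=> cr; exists (fun z => r (nfst z)); split.
  exact: computable_rat_comp cr recursive_nfst.
by move=> n k; rewrite npairE subrr normr0 invr_ge0 exprn_ge0.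
Qed.

Lemma computable_ratr_cst (q : rat) : computable_real_seq (fun=> ratr q : R).
Proof. exact: computable_real_ratr (computable_rat_cst q). Qed.

Lemma computable_real_approx r c : computable_rat_seq r ->
    (forall k, `|ratr (r k) - c| <= 2 ^- k) ->
  computable_real_seq (fun=> c).
Proof.
move=> cr rc; exists (fun z => r (nsnd z)); split.
  exact: computable_rat_comp cr recursive_nsnd.
by move=> n k; rewrite npairE.
Qed.

Lemma computable_real_comp x f : computable_real_seq x -> recursive f ->
  computable_real_seq (fun n => x (f n)).
Proof.
move=> [r [cr rx]] rf; exists (fun z => r (npair (f (nfst z)) (nsnd z))).
split; first by apply: computable_rat_comp cr _; recur.
by move=> n k; rewrite !npairE.
Qed.

Lemma computable_real_if b x y : recursive_pred b -> computable_real_seq x ->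
    computable_real_seq y ->
  computable_real_seq (fun n => if b n then x n else y n).
Proof.
move=> rb [r [cr rx]] [r' [cr' ry]].
exists (fun z => if b (nfst z) then r z else r' z); split.
  by apply: computable_rat_if => //; exact: recursive_pred_comp recursive_nfst.
by move=> n k; rewrite npairE; case: (b n).
Qed.

Lemma computable_real_frac p q : recursive p -> recursive q ->
    (forall n, q n != 0)%N ->
  computable_real_seq (fun n => (p n)%:R / (q n)%:R : R).
Proof.
move=> rp rq q0; have := computable_real_ratr (computable_rat_frac rp rq q0).
congr computable_real_seq; apply/funext => n.
by rewrite fmorph_div /= !ratr_nat.
Qed.

Lemma computable_real_adic b p m : recursive p -> recursive m ->
  computable_real_seq (fun n => (p n)%:R / (b.+1 ^ m n)%:R : R).
Proof.
move=> rp rm; apply: (computable_real_frac (q := fun n => b.+1 ^ m n)%N) => //.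
  by recur.
by move=> n; rewrite expn_eq0.
Qed.

Lemma sigma1_ltr x y : computable_real_seq x -> computable_real_seq y ->
  sigma1 (fun i => x i < y i).
Proof.
move=> [r [cr rx]] [r' [cr' ry]].
have : sigma1 (fun i => exists k,
    r (npair i k) + 2%:R / (2 ^ k)%:R < r' (npair i k)).
  apply: sigma1_ex; apply: sigma1_recursive; apply: recursive_ltr_rat.
    apply: computable_ratD; first by apply: computable_rat_comp cr _; recur.
    by apply: computable_rat_adic; recur.
  by apply: computable_rat_comp cr' _; recur.
apply: sigma1_ext => i.
have approxE k : (r (npair i k) + 2%:R / (2 ^ k)%:R < r' (npair i k)) =
    (ratr (r (npair i k)) + 2 * 2 ^- k < ratr (r' (npair i k)) :> R).
  by rewrite -(ltr_rat R) rmorphD /= fmorph_div /= !ratr_nat natrX.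
split=> [[k]|xy].
  rewrite approxE; have := rx i k; have := ry i k; rewrite !ler_distl.
  by lra.
have [|k k_small] := @exp2V_small ((y i - x i) / 4); first by lra.
exists k; rewrite approxE; have := rx i k; have := ry i k; rewrite !ler_distl.
by lra.
Qed.

Lemma sqrtn_floorE (N k j : nat) :
  (j * j <= N * 4 ^ k < j.+1 * j.+1)%N =
  (j%:R <= (Num.sqrt N%:R * 2 ^+ k : R) < j.+1%:R).
Proof.
have sqr_scaled : (Num.sqrt N%:R * 2 ^+ k) ^+ 2 = (N * 4 ^ k)%:R :> R.
  by rewrite exprMn sqr_sqrtr// natrM natrX (natrM _ 2 2) expr2 exprMn.
have scaled_ge0 : 0 <= Num.sqrt N%:R * 2 ^+ k :> R.
  by rewrite mulr_ge0 ?sqrtr_ge0 ?exprn_ge0.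
rewrite -(ler_nat R) -(ltr_nat R) -sqr_scaled !natrM -!expr2.
by rewrite ler_sqr ?nnegrE// ltr_sqr ?nnegrE.
Qed.

Lemma computable_sqrtn (N : nat) :
  computable_real_seq (fun=> Num.sqrt N%:R : R).
Proof.
pose floor k j := (j * j <= N * 4 ^ k < j.+1 * j.+1)%N.
have [||j rj jE] := @sigma1_choice floor.
- by apply: sigma1_recursive; rewrite /floor; recur.
- move=> k; exists (Num.truncn (Num.sqrt N%:R * 2 ^+ k : R)).
  rewrite /floor sqrtn_floorE; apply: truncn_itv.
  by rewrite mulr_ge0 ?sqrtr_ge0 ?exprn_ge0.
have cr : computable_rat_seq (fun k => (j k)%:R / (2 ^ k)%:R).
  by apply: computable_rat_adic; recur.
apply: computable_real_approx cr _ => k; have := jE k.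
rewrite /floor sqrtn_floorE -[(j k).+1%:R]natr1.
rewrite fmorph_div /= !ratr_nat natrX => /andP[ge_j lt_j].
have pow_gt0 : 0 < 2 ^+ k :> R by rewrite exprn_gt0.
rewrite ler_distl lerBlDr -[X in _ <= _ + X]mul1r -mulrDl.
rewrite ler_pdivlMr// (ltW lt_j) /= ler_pdivrMr// mulrDl mulVf ?gt_eqF//.
by rewrite ler_wpDr.
Qed.

Section Base4.
Variable digit : nat -> nat.

Fixpoint base4_prefix n := if n is m.+1 then
    (4 * base4_prefix m + digit (npair m (base4_prefix m)))%N
  else 0%N.

Definition base4_frac n : R := (base4_prefix n)%:R / 4 ^+ n.

Lemma recursive_base4_prefix : recursive digit -> recursive base4_prefix.
Proof.
move=> rd; apply: (@recursive_primrec _ 0%N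
  (fun z => 4 * nsnd z + digit (npair (nfst z) (nsnd z)))%N) => // [|m].
  by recur.
by rewrite !npairE.
Qed.

Lemma base4_limit : (forall z, digit z <= 1)%N ->
  exists c, forall n, `|base4_frac n - c| <= 4 ^- n / 3.
Proof.
move=> digit_le1; apply: telescope_limit => n.
  by rewrite divr_ge0// invr_ge0 exprn_ge0.
have pow_gt0 : 0 < 4 ^- n.+1 :> R by rewrite invr_gt0 exprn_gt0.
have powS : 4 ^- n = 4 * 4 ^- n.+1 :> R.
  by rewrite exprS invfM mulrA mulfV ?mul1r// pnatr_eq0.
have := digit_le1 (npair n (base4_prefix n)).
rewrite /base4_frac /= natrD natrM -(ler_nat R) powS.
set p := base4_prefix n; set b := digit _ => b_le1.
have b_ge0 : 0 <= b%:R :> R by rewrite ler0n.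
have -> : (4 * p%:R + b%:R) * 4 ^- n.+1 - p%:R * (4 * 4 ^- n.+1) =
    b%:R * 4 ^- n.+1 :> R by ring.
by rewrite ger0_norm ?mulr_ge0 ?(ltW pow_gt0)//; nra.
Qed.

Lemma computable_base4 : recursive digit -> (forall z, digit z <= 1)%N ->
  exists2 c, computable_real_seq (fun=> c) &
    forall n, `|base4_frac n - c| <= 4 ^- n / 3.
Proof.
move=> rd /base4_limit[c c_lim]; exists c => //.
have rp := recursive_base4_prefix rd.
have cr : computable_rat_seq (fun n => (base4_prefix n)%:R / (4 ^ n)%:R).
  by apply: computable_rat_adic; recur.
apply: computable_real_approx cr _ => n; rewrite fmorph_div /= !ratr_nat natrX.
apply: le_trans (c_lim n) _; apply: (@le_trans _ _ (4 ^- n)).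
  by rewrite ler_pdivrMr// ler_peMr ?ler1n// invr_ge0 exprn_ge0.
by rewrite lef_pV2 ?posrE ?exprn_gt0// lerXn2r ?nnegrE ?ler_nat.
Qed.

End Base4.

End ComputableReals.

(** * Effective Banach spaces *)

Section Scalars.
Variables (R : realType) (K : numFieldType) (sc : scalars R K).

Fact of_real_is_zmod_morphism : zmod_morphism (of_real sc).
Proof. by case: sc => //= x y; rewrite rmorphB. Qed.

Fact of_real_is_monoid_morphism : monoid_morphism (of_real sc).
Proof. by case: sc => //; split=> [|x y] /=; rewrite ?rmorph1 ?rmorphM. Qed.

HB.instance Definition _ :=
  GRing.isZmodMorphism.Build R K (of_real sc) of_real_is_zmod_morphism.
HB.instance Definition _ :=
  GRing.isMonoidMorphism.Build R K (of_real sc) of_real_is_monoid_morphism.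

Definition real_part : K -> R :=
  match sc in scalars _ K return K -> R with
  | RealScalars => fun x => x
  | ComplexScalars => fun x => complex.Re x
  end.

Lemma real_partK z : 0 <= z -> of_real sc (real_part z) = z.
Proof.
rewrite /real_part; case: sc z => //= -[x y].
by rewrite lecE /= => /andP[/eqP-> _].
Qed.

Lemma of_realK : cancel (of_real sc) real_part.
Proof. by rewrite /real_part; case: sc. Qed.

Lemma of_real_le x y : (of_real sc x <= of_real sc y) = (x <= y).
Proof. by case: sc => //=; rewrite lecR. Qed.

Lemma of_real_lt x y : (of_real sc x < of_real sc y) = (x < y).
Proof. by case: sc => //=; rewrite ltcR. Qed.

Lemma of_real_norm x : `|of_real sc x| = of_real sc `|x|.
Proof.
have [x0|x0] := lerP 0 x.
  by rewrite (ger0_norm x0) ger0_norm// -(rmorph0 (of_real sc)) of_real_le.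
rewrite (ltr0_norm x0) rmorphN ltr0_norm//.
by rewrite -(rmorph0 (of_real sc)) of_real_lt.
Qed.

Lemma of_real_dyadic m k : of_real sc (k%:R / (2 ^ m)%:R) = 2 ^- m * k%:R.
Proof. by rewrite fmorph_div !rmorph_nat natrX mulrC. Qed.

Lemma archimedean_scalars : Num.archimedean_axiom K.
Proof.
move=> x; have [n] := archimedean_real (real_part `|x|); exists n.
rewrite -(real_partK (normr_ge0 x)) -(rmorph_nat (of_real sc)) of_real_lt.
exact: le_lt_trans (ler_norm _) _.
Qed.

Lemma rational_of_real (q : rat) : rational_scalars sc (of_real sc (ratr q)).
Proof. by case: sc => /=; [exists q|exists q, 0; rewrite rmorph0]. Qed.

Lemma rational_scalarsM z w : rational_scalars sc z -> rational_scalars sc w ->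
  rational_scalars sc (z * w).
Proof.
case: sc z w => /= z w.
  by move=> [p ->] [q ->]; exists (p * q); rewrite rmorphM.
move=> [p [p' ->]] [q [q' ->]]; exists (p * q - p' * q'), (p * q' + p' * q).
by rewrite rmorphB rmorphD !rmorphM.
Qed.

Lemma computable_of_real x : computable_real_seq x ->
  computable_scalar_seq sc (fun i => of_real sc (x i)).
Proof.
case: sc => //= cx; split=> //.
by have := computable_ratr_cst R 0; rewrite rmorph0.
Qed.

Lemma computable_real_part z : computable_scalar_seq sc z ->
  computable_real_seq (fun i => real_part (z i)).
Proof. by rewrite /real_part; case: sc z => //= z []. Qed.

End Scalars.

Section RealNorm.
Variables (R : realType) (K : numFieldType) (sc : scalars R K).
Variable X : normedModType K.
Implicit Types (x y : X) (c : R).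

Definition rnorm x : R := real_part sc `|x|.

Lemma of_real_rnorm x : of_real sc (rnorm x) = `|x|.
Proof. exact: real_partK. Qed.

Lemma rnorm_le x c : (rnorm x <= c) = (`|x| <= of_real sc c).
Proof. by rewrite -of_real_rnorm of_real_le. Qed.

Lemma rnorm_lt x c : (rnorm x < c) = (`|x| < of_real sc c).
Proof. by rewrite -of_real_rnorm of_real_lt. Qed.

Lemma lt_rnorm x c : (c < rnorm x) = (of_real sc c < `|x|).
Proof. by rewrite -of_real_rnorm of_real_lt. Qed.

Lemma rnorm_ge0 x : 0 <= rnorm x.
Proof. by rewrite -(of_real_le sc) of_real_rnorm rmorph0. Qed.

Lemma rnorm_gt0 x : (0 < rnorm x) = (x != 0).
Proof. by rewrite lt_rnorm rmorph0 normr_gt0. Qed.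

Lemma rnormZ c x : rnorm (of_real sc c *: x) = `|c| * rnorm x.
Proof.
apply: (can_inj (of_realK sc)).
by rewrite rmorphM /= !of_real_rnorm normrZ of_real_norm.
Qed.

Lemma ler_rnormD x y : rnorm (x + y) <= rnorm x + rnorm y.
Proof. by rewrite rnorm_le rmorphD /= !of_real_rnorm ler_normD. Qed.

Lemma rnormB x y : rnorm (x - y) = rnorm (y - x).
Proof. by rewrite /rnorm distrC. Qed.

Lemma ler_rdist x y z : rnorm (x - z) <= rnorm (x - y) + rnorm (y - z).
Proof. by rewrite -[x - z](subrKA y) ler_rnormD. Qed.

End RealNorm.

Lemma bounded_linear_scale (K : numFieldType) (X : normedModType K) (c : K) :
  bounded_linear (fun x : X => c *: x).
Proof.
split; first by move=> k x y; rewrite scalerDr !scalerA mulrC.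
by exists `|c| => x; rewrite normrZ.
Qed.

Section ComputableSequences.
Variables (R : realType) (K : numFieldType) (sc : scalars R K).
Variables (X : completeNormedModType K) (S : set (nat -> X)).
Hypothesis hS : computability_structure sc S.
Implicit Types (x y : nat -> X) (f g : nat -> nat) (c d : nat -> R).

Lemma computable_seq_lin x y f g c d :
    S x -> S y -> recursive f -> recursive g ->
    computable_real_seq c -> computable_real_seq d ->
  S (fun n => of_real sc (c n) *: x (f n) + of_real sc (d n) *: y (g n)).
Proof.
move=> Sx Sy rf rg cc cd.
pose delta (h : nat -> nat) (b : nat -> R) n k :=
  of_real sc (if k == h n then b n else 0).
have cdelta h b : recursive h -> computable_real_seq b ->
    computable_scalar_seq sc (fun i => delta h b (nfst i) (nsnd i)).
  move=> rh cb; apply: computable_of_real; apply: computable_real_if.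
  - by recur.
  - by apply: computable_real_comp cb recursive_nfst.
  - by have := computable_ratr_cst R 0; rewrite rmorph0.
have rfg : recursive (fun n => f n + g n)%N by recur.
have := linear_forms_axiom hS Sx Sy (cdelta _ _ rf cc) (cdelta _ _ rg cd) rfg.
have sumE h b (z : nat -> X) n m : (h n <= m)%N ->
    \sum_(k < m.+1) delta h b n k *: z k = of_real sc (b n) *: z (h n).
  move=> hm; rewrite (bigD1 (Ordinal (n := m.+1) (m := h n) hm)) //=.
  rewrite {1}/delta eqxx big1 ?addr0// => k; rewrite -val_eqE /= => kh.
  by rewrite /delta (negPf kh) rmorph0 scale0r.
congr (S _); apply/funext => n.
by rewrite big_split /= !sumE ?leq_addl ?leq_addr.
Qed.

Lemma computable_seq_scale x f c :
    S x -> recursive f -> computable_real_seq c ->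
  S (fun n => of_real sc (c n) *: x (f n)).
Proof.
move=> Sx rf cc; have cst0 := computable_ratr_cst R 0.
have := computable_seq_lin Sx Sx rf rf cc cst0; congr (S _).
by apply/funext => n; rewrite !rmorph0 scale0r addr0.
Qed.

Lemma computable_seq_comp x f : S x -> recursive f -> S (fun n => x (f n)).
Proof.
move=> Sx rf; have cst1 := computable_ratr_cst R 1.
have := computable_seq_scale Sx rf cst1; congr (S _).
by apply/funext => n; rewrite !rmorph1 scale1r.
Qed.

Lemma computable_seqB x y : S x -> S y -> S (fun n => x n - y n).
Proof.
move=> Sx Sy; have cst1 := computable_ratr_cst R 1.
have cstN1 := computable_ratr_cst R (-1).
have := computable_seq_lin Sx Sy recursive_id recursive_id cst1 cstN1.
congr (S _).
by apply/funext => n; rewrite !(rmorphN, rmorph1) scale1r scaleN1r.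
Qed.

Lemma computable_rnorm x : S x -> computable_real_seq (fun n => rnorm sc (x n)).
Proof. by move=> /(norms_axiom hS)/computable_real_part. Qed.

Lemma computable_elements_scale (c : R) : computable_real_seq (fun=> c) ->
  (fun x : X => of_real sc c *: x) @` computable_elements S `<=`
    computable_elements S.
Proof.
by move=> cc _ [x Sx <-]; exact: computable_seq_scale Sx recursive_id cc.
Qed.

End ComputableSequences.

(** * Operators given by computable sequences *)

Lemma cvg_exp2V (K : numFieldType) (X : normedModType K) (u : nat -> X) x :
    Num.archimedean_axiom K -> (forall n, `|u n - x| < 2 ^- n) ->
  u @ \oo --> x.
Proof.
move=> archK ux; apply/cvgrPdist_lt => eps eps0.
have [m] := archimedean_exp2V 1 archK eps0; rewrite mulr1 => m_eps.
near=> n; rewrite distrC; apply: lt_trans (ux n) (le_lt_trans _ m_eps).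
rewrite lef_pV2 ?posrE ?exprn_gt0// ler_eXn2l ?ltr1n//.
by near: n; exact: nbhs_infty_ge.
Unshelve. all: by end_near.
Qed.

Section EffectiveOperators.
Variables (R : realType) (K : numFieldType) (sc : scalars R K).
Variables (X : completeNormedModType K) (S : set (nat -> X)).
Hypothesis hS : computability_structure sc S.
Variable a : nat -> X.
Hypothesis ha : S a.

Lemma computable_seq_approx (y : nat -> X) : S y ->
    (forall j, closure (range a) (y j)) ->
  exists2 g, recursive g & forall j n, `|y j - a (g (npair j n))| < 2 ^- n.
Proof.
move=> Sy ya; pose within z m :=
  rnorm sc (y (nfst z) - a m) < 1%:R / (2 ^ nsnd z)%:R.
have withinE z m : within z m <-> `|y (nfst z) - a m| < 2 ^- nsnd z.
  by rewrite /within rnorm_lt of_real_dyadic mulr1.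
have [||g rg gP] := @sigma1_choice within; last first.
- by exists g => // j n; have /withinE := gP (npair j n); rewrite !npairE.
- move=> z; have eps0 : 0 < 2 ^- nsnd z :> K by rewrite invr_gt0 exprn_gt0.
  have [_ [[m _ <-]]] := ya (nfst z) _ (nbhsx_ballx _ _ eps0).
  by rewrite -ball_normE => /withinE; exists m.
apply: sigma1_ltr.
  apply: (computable_rnorm hS); apply: (computable_seqB hS).
    by apply: (computable_seq_comp hS Sy); recur.
  by apply: (computable_seq_comp hS ha); recur.
by apply: computable_real_adic; recur.
Qed.

Lemma effective_lipschitz (F : X -> X) (M : nat) :
    (forall x y, `|F x - F y| <= M%:R * `|x - y|) ->
    S (fun j => F (a j)) -> (forall j, closure (range a) (F (a j))) ->
  effective a F.
Proof.
move=> lipF SFa Fa; have [g rg gP] := computable_seq_approx SFa Fa.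
have [c gc] := rg; have [d dc] : recursive (fun n => n + M.+1)%N by recur.
pose p e := comp_code c (pair_code (comp_code e d) 1).
have [q pq] : recursive p by rewrite /p; recur.
exists q => i x [f [fi _ fx]]; exists (p i); split; first exact: pq.
pose b n := g (npair (f (n + M.+1)%N) n.+1).
have bFx n : `|a (b n) - F x| < 2 ^- n.
  have -> : 2 ^- n = 2 ^- n.+1 + 2 ^- n.+1 :> K.
    by rewrite [LHS]splitr exprSr invfM.
  apply: le_lt_trans (ler_distD (F (a (f (n + M.+1)%N))) _ _) _.
  apply: ltr_leD; first by rewrite distrC; exact: gP.
  apply: le_trans (lipF _ _) _; rewrite addnS -addSn.
  apply: le_trans (ler_wpM2l (ler0n _ _) (ltW (fx _))) _.
  rewrite exprD invfM mulrCA ler_piMr ?invr_ge0 ?exprn_ge0//.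
  by rewrite ler_pdivrMr ?exprn_gt0// mul1r -natrX ler_nat ltnW// ltn_expl.
exists b; split=> //; last exact: cvg_exp2V (archimedean_scalars sc) bFx.
move=> n; apply: computes_comp (gc _); apply: computes_pair (computes_succ n).
exact: computes_comp (dc n) (fi _).
Qed.

End EffectiveOperators.

Section RationalSpan.
Variables (R : realType) (K : numFieldType) (sc : scalars R K).
Variables (X : completeNormedModType K) (e : nat -> X).

Lemma rational_spanZ (q : rat) x : rational_span sc e x ->
  rational_span sc e (of_real sc (ratr q) *: x).
Proof.
move=> [N [c [rc ->]]]; exists N, (fun i => of_real sc (ratr q) * c i); split.
  by move=> i; apply: rational_scalarsM => //; exact: rational_of_real.
by rewrite scaler_sumr; apply: eq_bigr => i _; rewrite scalerA.
Qed.

Lemma rational_span0 : rational_span sc e 0.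
Proof.
exists 0%N, (fun=> 0); rewrite big_ord0; split=> // i.
by have := rational_of_real sc 0; rewrite !rmorph0.
Qed.

Lemma rational_span_gen i : rational_span sc e (e i).
Proof.
exists i.+1, (fun k => of_real sc (k == i)%:R); split.
  by move=> k; have := rational_of_real sc (k == i)%:R; rewrite ratr_nat.
rewrite big_ord_recr /= eqxx rmorph1 scale1r big1 ?add0r// => k _.
by rewrite ltn_eqF// rmorph0 scale0r.
Qed.

Lemma dense_span_neq0 : dense (linear_span e) -> (exists x : X, x <> 0) ->
  exists i, e i <> 0.
Proof.
move=> e_dense [x x0]; apply: contrapT => /forallNP ne0.
have e0 i : e i = 0 by apply: contrapT; exact: ne0.
have [||y [/= y0 [N [c yE]]]] := e_dense (~` [set 0]); first by exists x.
  apply: closed_openC; apply: accessible_closed_set1.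
  exact/hausdorff_accessible/norm_hausdorff.
by apply: y0; rewrite yE big1// => i _; rewrite e0 scaler0.
Qed.

Lemma closure_rational_spanZ (c : R) x : rational_span sc e x ->
  closure (rational_span sc e) (of_real sc c *: x).
Proof.
move=> Ax B /nbhs_ballP[eps /= eps0 ballB].
have eps'0 : 0 < real_part sc eps.
  by rewrite -(of_real_lt sc) real_partK ?ltW// rmorph0.
pose d := real_part sc eps / (rnorm sc x + 1).
have x0 := rnorm_ge0 sc x.
have d0 : 0 < d by rewrite divr_gt0// ltr_wpDl.
have [|q] := @rat_in_itvoo R c (c + d); first by rewrite ltrDl.
rewrite in_itv /= => /andP[c_q q_c].
exists (of_real sc (ratr q) *: x); split; first exact: rational_spanZ.
apply: ballB; rewrite -ball_normE /= -(real_partK sc (ltW eps0)) -rnorm_lt.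
rewrite -scalerBl -rmorphB rnormZ distrC gtr0_norm ?subr_gt0//.
apply: (@le_lt_trans _ _ (d * rnorm sc x)).
  by rewrite ler_wpM2r// lerBlDl ltW.
by rewrite /d mulrAC ltr_pdivrMr ?ltr_wpDl// mulrDr mulr1 ltrDl.
Qed.

Lemma rational_span_unbounded (M : nat) (c : R) x : c != 0 ->
    rational_span sc e x -> x <> 0 ->
  exists2 y, rational_span sc e y & M%:R < `|of_real sc c *: y|.
Proof.
move=> c0 Ax /eqP x0; have w0 : 0 < `|c| * rnorm sc x.
  by rewrite mulr_gt0 ?normr_gt0// rnorm_gt0.
pose q : rat := (Num.truncn (M%:R / (`|c| * rnorm sc x))).+1%:R.
exists (of_real sc (ratr q) *: x); first exact: rational_spanZ.
rewrite -(rmorph_nat (of_real sc)) -lt_rnorm !rnormZ ratr_nat normr_nat.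
by rewrite mulrCA -ltr_pdivrMr// truncnS_gt.
Qed.

End RationalSpan.

Section Scaling.
Variables (R : realType) (K : numFieldType) (sc : scalars R K).
Variables (X : completeNormedModType K) (S : set (nat -> X)).
Hypothesis hS : computability_structure sc S.

Lemma effective_scale (e a : nat -> X) (c : R) : S a ->
    range a = rational_span sc e -> computable_real_seq (fun=> c) ->
  effective a (fun x => of_real sc c *: x).
Proof.
move=> ha haA cc.
apply: (effective_lipschitz hS ha (M := (Num.truncn `|c|).+1)).
- move=> x y; rewrite -scalerBr normrZ ler_wpM2r// of_real_norm.
  by rewrite -(rmorph_nat (of_real sc)) of_real_le ltW// truncnS_gt.
- exact: (computable_seq_scale hS ha recursive_id cc).
- move=> j; rewrite haA; apply: closure_rational_spanZ.
  by rewrite -haA; exists j.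
Qed.

Variables (x : nat -> X) (v : X).
Hypotheses (Sx : S x) (Sv : computable_elements S v) (v0 : v <> 0).

(* [b] is a candidate for the next base 4 digit of the scalar after the prefix
   [s]; the left-hand side bounds the contribution of all later digits. *)
Definition avoiding_digit n s b := (b <= 1)%N /\
  rnorm sc (of_real sc (1%:R / (3 * 4 ^ n.+1)%:R) *: v) <
  rnorm sc (of_real sc ((4 * s + b)%:R / (4 ^ n.+1)%:R) *: v - x n).

Lemma avoiding_digit_ex n s : exists b, avoiding_digit n s b.
Proof.
pose y b : X := of_real sc ((4 * s + b)%:R / (4 ^ n.+1)%:R) *: v.
have pow_gt0 : 0 < (4 ^ n.+1)%:R :> R by rewrite natrX exprn_gt0.
have dist_y : rnorm sc (y 1%N - y 0%N) = rnorm sc v / (4 ^ n.+1)%:R.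
  rewrite /y -scalerBl -rmorphB rnormZ -mulrBl -natrB ?leq_add2l// subnDl.
  by rewrite ger0_norm ?divr_ge0// mul1r mulrC.
have third_dist : rnorm sc (of_real sc (1%:R / (3 * 4 ^ n.+1)%:R) *: v) =
    rnorm sc v / (4 ^ n.+1)%:R / 3.
  rewrite rnormZ ger0_norm ?divr_ge0// mul1r mulrC natrM invfM.
  by rewrite mulrA mulrAC.
have dist_gt0 : 0 < rnorm sc v / (4 ^ n.+1)%:R.
  by rewrite divr_gt0// rnorm_gt0; exact/eqP.
have := ler_rdist sc (y 1%N) (x n) (y 0%N).
rewrite dist_y (rnormB _ (x n)) => tri.
rewrite /avoiding_digit third_dist.
have [y0|y0] := ltP (rnorm sc v / (4 ^ n.+1)%:R / 3) (rnorm sc (y 0%N - x n)).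
  by exists 0%N.
by exists 1%N; split=> //; rewrite -/(y 1%N); lra.
Qed.

Lemma sigma1_avoiding_digit :
  sigma1_rel (fun z b => avoiding_digit (nfst z) (nsnd z) b).
Proof.
have scale_frac p q : recursive p -> recursive q -> (forall z, q z != 0)%N ->
    S (fun z => of_real sc ((p z)%:R / (q z)%:R) *: v).
  move=> rp rq q0; have cpq := computable_real_frac R rp rq q0.
  exact: (computable_seq_scale hS Sv recursive_id cpq).
apply: sigma1_and; first by apply: sigma1_recursive; recur.
apply: sigma1_ltr; apply: (computable_rnorm hS).
  by apply: scale_frac; [recur..|] => z; rewrite muln_eq0 expn_eq0.
apply: (computable_seqB hS).
  by apply: scale_frac; [recur..|] => z; rewrite expn_eq0.
by apply: (computable_seq_comp hS Sx); recur.
Qed.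

Lemma scale_avoiding : exists2 c : R, computable_real_seq (fun=> c) &
  forall n, of_real sc c *: v <> x n.
Proof.
have [|f rf fP] := sigma1_choice sigma1_avoiding_digit.
  by move=> z; exact: avoiding_digit_ex.
have [c cc c_lim] := computable_base4 R rf (fun z => (fP z).1).
exists c => // n cvx; have [_] := fP (npair n (base4_prefix f n)).
rewrite !npairE -cvx -scalerBl -rmorphB !rnormZ ltNge => /negP; apply.
rewrite ler_wpM2r ?rnorm_ge0//; apply: le_trans (le_trans (c_lim n.+1) _).
  by rewrite /base4_frac natrX.
by rewrite ger0_norm ?divr_ge0// natrM natrX mul1r invfM mulrC.
Qed.

End Scaling.

(** * The numbering beta *)

Section Beta.
Variables (K : numFieldType) (X : completeNormedModType K) (a : nat -> X).

Definition valid_prefix e k m (f : nat -> nat) :=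
  (forall l, (l <= m)%N -> computes e l (f l)) /\
  (forall l, (l < m)%N -> `|a (f l.+1) - a (f l)| < 2 ^- l.+1 * k%:R).

Lemma valid_prefix_le e k m m' f : (m' <= m)%N ->
  valid_prefix e k m f -> valid_prefix e k m' f.
Proof.
by move=> m'm [vf df]; split=> l lm; [apply: vf|apply: df]; lia.
Qed.

Lemma valid_prefix_fun e k m k' m' f f' :
    valid_prefix e k m f -> valid_prefix e k' m' f' ->
  forall l, (l <= m)%N -> (l <= m')%N -> f l = f' l.
Proof.
by move=> [vf _] [vf' _] l lm lm'; exact: computes_fun (vf l lm) (vf' l lm').
Qed.

Lemma valid_prefix0 e k v : computes e 0 v -> valid_prefix e k 0 (fun=> v).
Proof. by move=> ev; split=> // l; rewrite leqn0 => /eqP->. Qed.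

Lemma exp2V_mul_ge0 n k : (0 : K) <= 2 ^- n * k%:R.
Proof. by rewrite mulr_ge0// invr_ge0 exprn_ge0. Qed.

Lemma valid_prefix_dist e k m p f : (m <= p)%N -> valid_prefix e k p f ->
  `|a (f p) - a (f m)| <= 2 ^- m * k%:R.
Proof.
move=> mp [_ df]; pose d l : K := 2 ^- l * k%:R.
apply: (@le_trans _ _ (d m - d p)); last by rewrite gerBl exp2V_mul_ge0.
apply: (ler_dist_telescope (x := a \o f)) => // l /andP[_ lp].
have -> : d l - d l.+1 = 2 ^- l.+1 * k%:R; last exact: ltW (df l lp).
by rewrite /d -mulrBl exprS invfM; congr (_ * _); field.
Qed.

Lemma valid_prefix_stage e k m f : valid_prefix e k m f ->
  exists n0, forall n l, (n0 <= n)%N -> (l <= m)%N -> phi n e l = Some (f l).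
Proof.
move=> [+ _]; elim: m => [|m IH] vf.
  have [n0 En0] := vf 0%N (leqnn _); exists n0 => n l n0n.
  by rewrite leqn0 => /eqP->; exact: phi_mono En0.
have [|n0 En0] := IH; first by move=> l lm; apply: vf; lia.
have [n1 En1] := vf m.+1 (leqnn _); exists (maxn n0 n1) => n l nn.
rewrite leq_eqVlt => /predU1P[->|lm]; first by apply: phi_mono En1; lia.
by apply: En0; lia.
Qed.

Definition visible e k n m :=
  all (halts n e) (iota 0 m.+1) && all (Defs.close a e k n) (iota 1 m).

Lemma visibleP e k n m : reflect
  ((forall l, (l <= m)%N -> halts n e l) /\
   (forall l, (l < m)%N -> Defs.close a e k n l.+1)) (visible e k n m).
Proof.
apply: (iffP andP) => -[haltsm closem]; split.
- by move=> l lm; apply: (allP haltsm); rewrite mem_iota.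
- by move=> l lm; apply: (allP closem); rewrite mem_iota; lia.
- by apply/allP => l; rewrite mem_iota => /andP[_]; exact: haltsm.
- by apply/allP => -[|l]; rewrite mem_iota //= add1n ltnS; exact: closem.
Qed.

Lemma eligible_visible e k n m : eligible a e k n m = visible e k n m &&
  [|| [forall n' : 'I_n, ~~ halts n' e m],
      ~~ halts n e m.+1 | ~~ Defs.close a e k n m.+1].
Proof. by rewrite /eligible andbA. Qed.

Lemma visible_lt e k n m : visible e k n m -> (m < n)%N.
Proof.
move=> /visibleP[/(_ m (leqnn m)) + _]; rewrite /halts.
by case E: (phi n e m) => // _; exact: phi_lt E.
Qed.

Lemma visibleS e k n m : visible e k n m -> halts n e m.+1 ->
  Defs.close a e k n m.+1 -> visible e k n m.+1.
Proof.
move=> /visibleP[haltsm closem] haltsS closeS; apply/visibleP.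
split=> l; rewrite leq_eqVlt => /predU1P[]; first by move->.
- exact: haltsm.
- by case=> ->.
- exact: closem.
Qed.

(* The last visible position is eligible. *)
Lemma eligible_find e k n : halts n e 0 ->
  eligible a e k n (find (eligible a e k n) (iota 0 n)).
Proof.
move=> halts0; have visible0 : visible e k n 0 by rewrite /visible /= halts0.
have [M visM Mmax] := ex_maxnP (ex_intro (visible e k n) 0%N visible0)
  (fun m vism => ltnW (visible_lt vism)).
have has_eligible : has (eligible a e k n) (iota 0 n).
  apply/hasP; exists M; first by rewrite mem_iota (visible_lt visM).
  rewrite eligible_visible visM /=; apply/orP; right; rewrite -negb_and.
  apply/negP => /andP[haltsS closeS].
  by have := Mmax _ (visibleS visM haltsS closeS); rewrite ltnn.
have find_lt : (find (eligible a e k n) (iota 0 n) < n)%N.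
  by move: has_eligible; rewrite has_find size_iota.
by have := nth_find 0%N has_eligible; rewrite nth_iota.
Qed.

Lemma quasi_seq_valid_prefix e k m f : valid_prefix e k m f ->
  exists n0, forall n, (n0 <= n)%N -> exists p f',
    [/\ (m <= p)%N, valid_prefix e k p f' & quasi_seq a e k n = a (f' p)].
Proof.
move=> vf; have [n0 En0] := valid_prefix_stage vf; exists n0.+1 => n n0n.
have phif l : (l <= m)%N -> phi n e l = Some (f l) by apply: En0; lia.
have halts0 : halts n e 0 by rewrite /halts phif.
have := eligible_find k halts0; rewrite /quasi_seq halts0.
set p := find _ _; rewrite eligible_visible.
move=> /andP[/visibleP[haltsp closep] stopp].
pose f' l := odflt 0%N (phi n e l).
have phif' l : (l <= p)%N -> phi n e l = Some (f' l).
  by move=> /haltsp; rewrite /halts /f'; case: (phi n e l).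
exists p, f'; split=> //; last first.
  by split=> [l /phif'|l /closep//]; exists n.
rewrite leqNgt; apply/negP => pm; case/or3P: stopp.
- move/forallP => /(_ (Ordinal n0n)) /=.
  by rewrite /halts En0// ltnW.
- by rewrite /halts phif.
- by rewrite /Defs.close /Defs.approx (phif _ pm) (phif _ (ltnW pm)) /= vf.2.
Qed.

Definition maximal_prefix e k m f :=
  valid_prefix e k m f /\ forall f', ~ valid_prefix e k m.+1 f'.

Definition endless e k := forall m, exists f, valid_prefix e k m f.

Variant course e k : Prop :=
  | CourseUndefined of forall v, ~ computes e 0 v
  | CourseMaximal m f of maximal_prefix e k m f
  | CourseEndless of endless e k.

Lemma courseP e k : course e k.
Proof.
have [[v ev]|undef] := pselect (exists v, computes e 0 v); last first.
  by apply: CourseUndefined => v ev; apply: undef; exists v.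
have [/CourseEndless //|] := pselect (endless e k).
move=> /existsNP[m]; elim: m => [|m IH] stop.
  by case: stop; exists (fun=> v); exact: valid_prefix0.
have [[f vf]|/IH//] := pselect (exists f, valid_prefix e k m f).
by apply: (@CourseMaximal _ _ m f); split=> // f' vf'; apply: stop; exists f'.
Qed.

Lemma quasi_seq_undef e k : (forall v, ~ computes e 0 v) ->
  quasi_seq a e k @ \oo --> a 0%N.
Proof.
move=> undef; apply: cvg_near_cst; near=> n; rewrite /quasi_seq /halts.
by case E: (phi n e 0) => [v|] //; case: (undef v); exists n.
Unshelve. all: by end_near.
Qed.

Lemma quasi_seq_maximal e k m f : maximal_prefix e k m f ->
  quasi_seq a e k @ \oo --> a (f m).
Proof.
move=> [vf fmax]; have [n0 En0] := quasi_seq_valid_prefix vf.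
apply: cvg_near_cst; near=> n.
have [|p [f' [mp vf' ->]]] := En0 n; first by near: n; exact: nbhs_infty_ge.
have pm : p = m.
  apply/eqP; rewrite eqn_leq mp andbT leqNgt; apply/negP => lt_mp.
  exact: fmax (valid_prefix_le lt_mp vf').
by rewrite pm in vf' *; rewrite (valid_prefix_fun vf vf').
Unshelve. all: by end_near.
Qed.

Hypothesis archimedeanK : Num.archimedean_axiom K.

Lemma quasi_seq_endless e k : endless e k -> cvg (quasi_seq a e k @ \oo).
Proof.
move=> prefixes; apply/cauchy_cvgP; apply: cauchy_exP => eps eps0.
have [m m_eps] := archimedean_exp2V k archimedeanK eps0.
have [f vf] := prefixes m; have [n0 En0] := quasi_seq_valid_prefix vf.
exists (a (f m)); exists n0 => // n /= n0n; rewrite -ball_normE /=.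
have [p [f' [mp vf' ->]]] := En0 n n0n.
rewrite (valid_prefix_fun vf vf') ?leqnn// distrC.
exact: le_lt_trans (valid_prefix_dist mp vf') m_eps.
Qed.

Lemma quasi_seq_cvg e k : cvg (quasi_seq a e k @ \oo).
Proof.
case: (courseP e k) => [undef|m f fmax|]; last exact: quasi_seq_endless.
- exact: cvgP (quasi_seq_undef k undef).
- exact: cvgP (quasi_seq_maximal fmax).
Qed.

Lemma beta_undef e k : (forall v, ~ computes e 0 v) ->
  beta a (npair e k) = a 0%N.
Proof.
move=> undef; rewrite /beta !npairE; apply: cvg_lim => //.
exact: quasi_seq_undef.
Qed.

Lemma beta_maximal e k m f : maximal_prefix e k m f ->
  beta a (npair e k) = a (f m).
Proof.
move=> fmax; rewrite /beta !npairE; apply: cvg_lim => //.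
exact: quasi_seq_maximal.
Qed.

Lemma beta_one_value e k v : computes e 0 v -> (forall y, ~ computes e 1 y) ->
  beta a (npair e k) = a v.
Proof.
move=> ev undef1; apply: (@beta_maximal _ _ 0 (fun=> v)).
split; first exact: valid_prefix0.
by move=> f [/(_ 1%N (leqnn _)) /undef1].
Qed.

Lemma beta_two_values e k v w : computes e 0 v -> computes e 1 w ->
    (forall y, ~ computes e 2 y) -> 2 * `|a w - a v| < k%:R ->
  beta a (npair e k) = a w.
Proof.
move=> ev ew undef2 vw.
apply: (@beta_maximal _ _ 1 (fun l => if l == 0%N then v else w)).
split; last by move=> f [/(_ 2%N (leqnn _)) /undef2].
split=> [[|[|l]]|[|l]]// _.
by rewrite expr1 mulrC ltr_pdivlMr// mulrC.
Qed.

Lemma beta_valid_prefix e k m f : valid_prefix e k m f ->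
  `|beta a (npair e k) - a (f m)| <= 2 ^- m * k%:R.
Proof.
move=> vf; rewrite /beta !npairE.
have [n0 En0] := quasi_seq_valid_prefix vf.
apply/ler_addgt0Pr => eps eps0.
have [N _ lim_near] := cvgr_dist_le _ _ (@quasi_seq_cvg e k) _ eps0.
have [p [f' [mp vf' qE]]] := En0 (maxn N n0) (leq_maxr _ _).
have := lim_near (maxn N n0) (leq_maxl _ _); rewrite /= qE => dist_p.
apply: le_trans (ler_distD (a (f' p)) _ _) _; rewrite addrC lerD//.
rewrite (valid_prefix_fun vf vf' (leqnn m) mp).
exact: valid_prefix_dist mp vf'.
Qed.

Lemma beta_endless e k : ~ range a (beta a (npair e k)) -> endless e k.
Proof.
case: (courseP e k) => // [/beta_undef->|m f /beta_maximal->] [].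
- by exists 0%N.
- by exists (f m).
Qed.

End Beta.

(** * Operators that are not quasi-effective *)

Section NotQuasiEffective.
Variables (R : realType) (K : numFieldType) (sc : scalars R K).
Variables (X : completeNormedModType K) (S : set (nat -> X)).
Hypothesis hS : computability_structure sc S.
Variable a : nat -> X.
Hypothesis ha : S a.

Lemma quasi_effective_recursive (F : X -> X) : quasi_effective a F ->
  exists2 psi, recursive psi & forall i, F (beta a i) = beta a (psi i).
Proof.
move=> [p /choice[psi psiP]]; exists psi; last by move=> i; have [] := psiP i.
by exists p => i; have [] := psiP i.
Qed.

(* A finite part of the sequence with code [j] confines its limit to a ball
   that does not contain [x]. *)
Definition seen_apart j x := exists m T,
  valid_prefix a (nfst j) (nsnd j) m (lookup T) /\
  2 ^- m * (nsnd j)%:R < `|x - a (lookup T m)|.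

Lemma valid_prefix_seen_apart j x m f : valid_prefix a (nfst j) (nsnd j) m f ->
  2 ^- m * (nsnd j)%:R < `|x - a (f m)| -> seen_apart j x.
Proof.
move=> [cf df] far; have [T Tf] := lookup_onto m.+1 f.
exists m, T; rewrite Tf//; split=> //.
by split=> l lm; rewrite !Tf; [exact: cf|lia|exact: df|lia|lia].
Qed.

Lemma beta_seen_apart j x : seen_apart j x -> beta a j <> x.
Proof.
move=> [m [T [vT]]] /[swap] <-.
have := beta_valid_prefix (archimedean_scalars sc) vT; rewrite npairK.
by move=> /le_lt_trans/[apply]; rewrite ltxx.
Qed.

Lemma endless_seen_apart j x : endless a (nfst j) (nsnd j) ->
  beta a j <> x -> seen_apart j x.
Proof.
move=> prefixes /eqP; rewrite -subr_eq0 -normr_gt0 => dist0.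
have dist20 : 0 < `|beta a j - x| / 2 by rewrite divr_gt0.
have [m m_dist] := archimedean_exp2V (nsnd j) (archimedean_scalars sc) dist20.
have [f vf] := prefixes m; apply: (valid_prefix_seen_apart vf).
have := beta_valid_prefix (archimedean_scalars sc) vf; rewrite npairK => near.
have tri := ler_distD (a (f m)) (beta a j) x.
rewrite distrC -(ltrD2l (2 ^- m * (nsnd j)%:R)).
apply: lt_le_trans (le_trans tri (lerD near (lexx _))).
by rewrite [ltRHS]splitr ltrD.
Qed.

Lemma sigma1_valid_prefix e k m T : recursive e -> recursive k ->
    recursive m -> recursive T ->
  sigma1 (fun i => valid_prefix a (e i) (k i) (m i) (lookup (T i))).
Proof.
move=> re rk rm rT; apply: sigma1_and.
  apply: (@sigma1_bounded_forall (fun i => (m i).+1)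
    (fun i l => computes (e i) l (lookup (T i) l))); first by recur.
  by apply: sigma1_computes; recur.
apply: sigma1_bounded_forall => //.
have : sigma1 (fun z =>
    rnorm sc (a (lookup (T (nfst z)) (nsnd z).+1) -
              a (lookup (T (nfst z)) (nsnd z))) <
    (k (nfst z))%:R / (2 ^ (nsnd z).+1)%:R).
  apply: sigma1_ltr; last by apply: computable_real_adic; recur.
  apply: (computable_rnorm hS); apply: (computable_seqB hS);
    by apply: (computable_seq_comp hS ha); recur.
by apply: sigma1_ext => z; rewrite rnorm_lt of_real_dyadic.
Qed.

Lemma sigma1_seen_apart j x : recursive j -> S x ->
  sigma1 (fun i => seen_apart (j i) (x i)).
Proof.
move=> rj Sx; apply: sigma1_ex; apply: sigma1_ex; apply: sigma1_and.
  apply: sigma1_valid_prefix; recur.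
have : sigma1 (fun z =>
    (nsnd (j (nfst (nfst z))))%:R / (2 ^ (nsnd (nfst z)))%:R <
    rnorm sc (x (nfst (nfst z)) - a (lookup (nsnd z) (nsnd (nfst z))))).
  apply: sigma1_ltr; first by apply: computable_real_adic; recur.
  apply: (computable_rnorm hS); apply: (computable_seqB hS).
    by apply: (computable_seq_comp hS Sx); recur.
  by apply: (computable_seq_comp hS ha); recur.
by apply: sigma1_ext => z; rewrite lt_rnorm of_real_dyadic.
Qed.

Lemma not_quasi_effective_leaving_range (F : X -> X) v w :
    ~ range a (F (a v)) -> F (a w) <> F (a v) ->
    computable_elements S (F (a w)) ->
  ~ quasi_effective a F.
Proof.
move=> Fv Fw SFw /quasi_effective_recursive[psi rpsi psiP].
have [k lt_k] : exists k : nat, 2 * `|a w - a v| < k%:R.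
  have [k] := archimedean_scalars sc (2 * `|a w - a v|).
  by rewrite ger0_norm ?mulr_ge0//; exists k.
have [|c cP] := @recursion_theorem (fun c x y => (x == 0%N) && (y == v) \/
    (x == 1%N) && (y == w) /\ seen_apart (psi (npair c k)) (F (a w))).
  apply: sigma1_or; first by apply: sigma1_recursive; recur.
  apply: sigma1_and; first by apply: sigma1_recursive; recur.
  apply: sigma1_seen_apart; first by recur.
  exact: (computable_seq_comp hS SFw recursive_id).
have Fbeta := psiP (npair c k); set j := psi _ in Fbeta cP.
have c0 : computes c 0 v.
  apply: (uniformizes_det cP); first by left; rewrite !eqxx.
  by move=> y [/andP[_ /eqP]|[]].
have [seen|unseen] := pselect (seen_apart j (F (a w))).
  have c1 : computes c 1 w.
    apply: (uniformizes_det cP); first by right; rewrite !eqxx.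
    by move=> y [|[/andP[_ /eqP]]].
  apply: (beta_seen_apart seen); rewrite -Fbeta.
  by rewrite (beta_two_values c0 c1)// => y /(cP 2%N).1 [|[]].
apply: (unseen); have beta_j : beta a j = F (a v).
  rewrite -Fbeta (beta_one_value a _ c0)// => y.
  by move/(cP 1%N).1 => [|[_ /unseen]].
apply: endless_seen_apart; last by rewrite beta_j => /esym.
by apply: beta_endless; rewrite npairK beta_j.
Qed.

Lemma not_quasi_effective_unbounded (F : X -> X) : F (a 0%N) <> a 0%N ->
    S (fun n => F (a n)) -> (forall M : nat, exists n, M%:R < `|F (a n)|) ->
  ~ quasi_effective a F.
Proof.
move=> F0 SFa F_unbounded /quasi_effective_recursive[psi rpsi psiP].
have [|c cP] := @recursion_theorem (fun c x y =>
    x == 0%N /\ seen_apart (psi (npair c 0)) (F (a y))).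
  apply: sigma1_and; first by apply: sigma1_recursive; recur.
  apply: (@sigma1_seen_apart _ (fun z => F (a (nsnd z)))); first by recur.
  exact: (computable_seq_comp hS SFa recursive_nsnd).
have Fbeta := psiP (npair c 0); set j := psi _ in Fbeta cP.
have [[y c0]|undef] := pselect (exists y, computes c 0 y).
  have [_ seen] := (cP 0%N).1 _ c0; apply: (beta_seen_apart seen).
  by rewrite -Fbeta (beta_one_value a _ c0)// => z /(cP 1%N).1 [].
have beta0 : beta a (npair c 0) = a 0%N.
  by apply: beta_undef => y c0; apply: undef; exists y.
have [u ju] : exists u, computes (nfst j) 0 u.
  apply: contrapT => j_undef; apply: F0; rewrite -beta0 Fbeta -[j]npairK.
  by rewrite beta0 beta_undef// => u ju; apply: j_undef; exists u.
have [M] := archimedean_scalars sc ((nsnd j)%:R + `|a u|).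
rewrite ger0_norm ?addr_ge0// => ltM.
have [y yM] := F_unbounded M; apply: undef; apply: (cP 0%N).2; exists y.
split=> //; apply: (valid_prefix_seen_apart (valid_prefix0 a _ ju)).
rewrite expr0 invr1 mul1r; apply: lt_le_trans (lerB_dist _ _).
by rewrite ltrBrDr (lt_trans ltM yM).
Qed.

End NotQuasiEffective.

Section ScalingNotQuasiEffective.
Variables (R : realType) (K : numFieldType) (sc : scalars R K).
Variables (X : completeNormedModType K) (S : set (nat -> X)).
Hypothesis hS : computability_structure sc S.
Variables (e a : nat -> X).
Hypotheses (ha : S a) (haA : range a = rational_span sc e).

Lemma scale_not_quasi_effective_leaving_span c x : rational_span sc e x ->
    ~ rational_span sc e (of_real sc c *: x) ->
  ~ quasi_effective a (fun y => of_real sc c *: y).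
Proof.
rewrite -haA => -[v _ <-] cv.
have [w _ aw] : range a 0 by rewrite haA; exact: rational_span0.
apply: (not_quasi_effective_leaving_range hS ha (v := v) (w := w)) => //.
  by rewrite aw scaler0 => cv0; apply: cv; rewrite -cv0; exists w.
rewrite aw scaler0 -aw; exact: (computable_seq_comp hS ha (recursive_cst w)).
Qed.

Lemma scale_not_quasi_effective_default_neq0 c :
    computable_real_seq (fun=> c) -> c != 0 -> c != 1 -> a 0%N <> 0 ->
  ~ quasi_effective a (fun y => of_real sc c *: y).
Proof.
move=> cc c0 c1 a0; apply: (not_quasi_effective_unbounded hS ha).
- move/eqP; rewrite -subr_eq0 -[X in _ - X]scale1r -(rmorph1 (of_real sc)).
  rewrite -scalerBl -rmorphB scaler_eq0 fmorph_eq0 subr_eq0 (negPf c1).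
  by move/eqP.
- exact: (computable_seq_scale hS ha recursive_id cc).
- have A0 : rational_span sc e (a 0%N) by rewrite -haA; exists 0%N.
  move=> M; have [y] := rational_span_unbounded M c0 A0 a0.
  by rewrite -haA => -[n _ <-]; exists n.
Qed.

Lemma exists_scale_not_quasi_effective : (exists v, a v <> 0) ->
  exists2 c, computable_real_seq (fun=> c) &
    ~ quasi_effective a (fun x => of_real sc c *: x).
Proof.
move=> [v av]; have Sv := computable_seq_comp hS ha (recursive_cst v).
have [c cc cv] := scale_avoiding hS ha Sv av; exists c => //.
apply: (@scale_not_quasi_effective_leaving_span _ (a v)).
  by rewrite -haA; exists v.
by rewrite -haA => -[n _ /esym/cv].
Qed.

End ScalingNotQuasiEffective.

Theorem theorem28 (R : realType) (K : numFieldType) (sc : scalars R K)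
    (X : completeNormedModType K)
    (S : set (nat -> X)) (hS : computability_structure sc S)
    (e : nat -> X) (he : S e) (hdense : dense (linear_span e))
    (a : nat -> X) (ha : S a) (haA : range a = rational_span sc e)
    (hX : exists x : X, x <> 0) :
  let sqrt2 := fun x : X => of_real sc (Num.sqrt 2) *: x in
  [/\ exists F : X -> X,
        [/\ bounded_linear F,
            F @` computable_elements S `<=` computable_elements S &
            ~ quasi_effective a F],
      bounded_linear sqrt2,
      effective a sqrt2 &
      (a 0%N <> 0 \/
       exists2 x, rational_span sc e x & ~ rational_span sc e (sqrt2 x)) ->
      ~ quasi_effective a sqrt2].
Proof.
move=> sqrt2; have cs := computable_sqrtn R 2; split.
- have [i ei] := dense_span_neq0 hdense hX.
  have [v _ av] : range a (e i) by rewrite haA; exact: rational_span_gen.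
  have [|c cc not_qe] := exists_scale_not_quasi_effective hS ha haA.
    by exists v; rewrite av.
  exists (fun x => of_real sc c *: x); split=> //.
    exact: bounded_linear_scale.
  exact: computable_elements_scale hS c cc.
- exact: bounded_linear_scale.
- exact: effective_scale hS e a _ ha haA cs.
- have s1 : 1 < Num.sqrt 2 :> R by rewrite -[ltLHS]sqrtr1 ltr_sqrt// ltr1n.
  case=> [a0|[x Ax nAx]].
    apply: (scale_not_quasi_effective_default_neq0 hS ha haA cs _ _ a0).
      by rewrite gt_eqF// (lt_trans ltr01).
    by rewrite gt_eqF.
  exact: (scale_not_quasi_effective_leaving_span hS ha haA Ax).
Qed.
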